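(* Let $r\ge 2$ and let $P$ be a positroid isomorphic to the whirl $\mathcal{W}^r$. Then matroid isomorphism yields a bijection \[\Omega_P \cong \{ M(\mathcal{N}_r),\ \mathcal{N}^r,\ M(\mathcal{W}_r),\ \mathcal{W}^r \},\] i.e. $\Omega_P$ consists of exactly four ordered matroids, one isomorphic to each of the four listed matroids.
   Context: An ordered matroid is a (finite) matroid whose ground set is totally ordered. A positroid is an ordered matroid on $\{i_1<\dots<i_n\}$, of rank $r$, that can be realized by a full-rank real $r\times n$ matrix (columns indexed in order) all of whose maximal minors are nonnegative. On $E=\{i_1<\dots<i_n\}$ let $\leq_{i_k}$ be the order $i_k<i_{k+1}<\dots<i_n<i_1<\dots<i_{k-1}$. The Grassmann necklace of an ordered matroid $M$ on $E$ is $\mathcal{J}(M)=(J_1,\dots,J_n)$, with $J_j$ the lexicographically minimal basis of $M$ with respect to $\leq_{i_j}$. For a positroid $P$, its positroid envelope class $\Omega_P$ is the set of all ordered matroids $M$ on the ordered set $E(P)$ with $\mathcal{J}(M)=\mathcal{J}(P)$. For $r\ge2$: the wheel graph $\mathcal{W}_r$ is a cycle with $r$ vertices and $r$ edges (two parallel edges if $r=2$) together with a new vertex joined by one edge (a spoke) to each cycle vertex; the edge set $R$ of the cycle is the rim. $M(\cdot)$ denotes cycle matroid. $\mathcal{W}^r$ is the matroid on $E(\mathcal{W}_r)$ with bases $\mathcal{B}(M(\mathcal{W}_r))\cup\{R\}$. $\mathcal{N}_r$ is the graph formed by a cycle of length $r$ glued at one vertex to a graph with two vertices and $r$ parallel edges;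 $\mathcal{N}^r$ is the matroid on $E(\mathcal{N}_r)$ with bases $\mathcal{B}(M(\mathcal{N}_r))\cup\{R'\}$, $R'$ being the edge set of the cycle of length $r$. (For $r=2$ one has $\mathcal{N}^2\cong M(\mathcal{W}_2)$; the displayed set is then regarded as a list of four matroids with this isomorphism type occurring twice.) *)

(* Defs.v *)
From HB Require Import structures.
From mathcomp Require Import all_boot all_order all_algebra.
From mathcomp Require Import reals.

Set Implicit Arguments.
Unset Strict Implicit.
Unset Printing Implicit Defensive.

Import Order.TTheory GRing.Theory Num.Theory.

(** * Matroids *)

Definition basis_axioms (E : finType) (Bs : {set {set E}}) : bool :=
  (Bs != set0) &&
  [forall A in Bs, forall B in Bs, forall x in A :\: B,
    exists y in B :\: A, y |: (A :\ x) \in Bs].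

Record matroid (E : finType) := Matroid {
  bases : {set {set E}};
  basesP : basis_axioms bases
}.

HB.instance Definition _ (E : finType) := [isSub for @bases E].
#[hnf] HB.instance Definition _ (E : finType) := [Finite of matroid E by <:].

(* Isomorphism is a relation between families of bases, so that a listed
   matroid can be given by its family of bases.  A family isomorphic to
   [bases M] satisfies [basis_axioms] because [bases M] does. *)
Definition isomorphic (E F : finType) (Bs : {set {set E}}) (Cs : {set {set F}})
  : Prop :=
  exists f : E -> F,
    bijective f /\ forall B : {set E}, (f @: B \in Cs) = (B \in Bs).

(** * Ordered matroids *)

(* The order  a < ... < max E < min E < ... < pred a  on [E]: two elements on
   the same side of [a] keep their order, and those [>= a] come first. *)
Definition cyc_le d (E : finOrderType d) (a : E) : rel E :=
  fun x y => if (a <= x)%O == (a <= y)%O then (x <= y)%O else (a <= x)%O.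

Fixpoint lexi_le (T : Type) (le : rel T) (s t : seq T) : bool :=
  match s, t with
  | [::], _ => true
  | _ :: _, [::] => false
  | x :: s', y :: t' => le x y && (le y x ==> lexi_le le s' t')
  end.

Definition set_lexi_le d (E : finOrderType d) (a : E) : rel {set E} :=
  fun A B => lexi_le (cyc_le a) (sort (cyc_le a) (enum A))
                                (sort (cyc_le a) (enum B)).

(* The entry at [a] is the lexicographically minimal basis for [cyc_le a]; the
   default [set0] is never used, see [grassmann_necklaceP]. *)
Definition grassmann_necklace d (E : finOrderType d) (M : matroid E)
  : {ffun E -> {set E}} :=
  [ffun a => odflt set0
     [pick J in bases M | [forall B in bases M, set_lexi_le a J B]]].

Definition positroid_envelope d (E : finOrderType d) (P : matroid E)
  : {set matroid E} :=
  [set M | grassmann_necklace M == grassmann_necklace P].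

(* Column [j] of [A] represents the [j]-th smallest element of [E]; maximal
   minors are indexed by increasing choices [f] of [k] columns. *)
Definition positroid (R : realType) d (E : finOrderType d) (M : matroid E)
  : Prop :=
  exists (k : nat) (A : 'M[R]_(k, #|E|)),
    [/\ \rank A = k,
        forall f : 'I_k -> 'I_#|E|, {homo f : i j / (i < j)%N} ->
          (0 <= \det (colsub f A))%R
      & forall B : {set E}, B \in bases M <->
          exists f : 'I_k -> 'I_#|E|,
            [/\ {homo f : i j / (i < j)%N},
                B = [set Order.enum_val (f i) | i : 'I_k]
              & (\det (colsub f A) != 0)%R]].

(** * Cycle matroids *)

(* A multigraph on [V] with edges labelled by [E]; the two endpoints of an
   edge are listed in an arbitrary order. *)
Definition multigraph (V E : finType) := E -> V * V.

Section CycleMatroid.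
Variables (V E : finType) (G : multigraph V E).

Definition joins (e : E) (u v : V) : bool :=
  (G e == (u, v)) || (G e == (v, u)).

(* [C] is the edge set of a cycle v_0, e_0, v_1, e_1, ..., v_0 of the graph:
   the entry (v_i, e_i) of [s] is a vertex together with the edge that leads
   to the next vertex.  A loop is a cycle of length 1, a pair of parallel
   edges a cycle of length 2. *)
Definition is_cycle (C : {set E}) : bool :=
  (C != set0) &&
  [exists s : #|C|.-tuple (V * E),
    [&& uniq (unzip1 s), uniq (unzip2 s), [set e in unzip2 s] == C
      & cycle (fun p q => joins p.2 p.1 q.1) s]].

Definition acyclic (A : {set E}) : bool :=
  [forall C : {set E}, is_cycle C ==> ~~ (C \subset A)].

Definition cycle_matroid_bases : {set {set E}} :=
  [set B : {set E} | maxset acyclic B].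

End CycleMatroid.

(** * Wheels, whirls and the graphs N_r (meaningful for r >= 2) *)

(* In both graphs the vertices 0, ..., r-1 of ['I_r.+1] are on the cycle and
   [ord_max] is the additional vertex; [inl i] is the [i]-th edge of the cycle
   and [inr i] the [i]-th remaining edge. *)
Definition wheel (r : nat) : multigraph 'I_r.+1 ('I_r + 'I_r)%type :=
  fun e => match e with
           | inl i => (inord i, inord (i.+1 %% r))
           | inr i => (ord_max, inord i)
           end.

Definition Ngraph (r : nat) : multigraph 'I_r.+1 ('I_r + 'I_r)%type :=
  fun e => match e with
           | inl i => (inord i, inord (i.+1 %% r))
           | inr _ => (ord0, ord_max)
           end.

Arguments wheel : clear implicits.
Arguments Ngraph : clear implicits.

Definition rim (r : nat) : {set 'I_r + 'I_r} := [set inl i | i : 'I_r].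

Definition MW (r : nat) : {set {set 'I_r + 'I_r}} :=
  cycle_matroid_bases (wheel r).

Definition whirl (r : nat) : {set {set 'I_r + 'I_r}} := rim r |: MW r.

Definition MN (r : nat) : {set {set 'I_r + 'I_r}} :=
  cycle_matroid_bases (Ngraph r).

Definition MN_relaxed (r : nat) : {set {set 'I_r + 'I_r}} := rim r |: MN r.

Definition whirl_envelope_list (r : nat) : 4.-tuple {set {set 'I_r + 'I_r}} :=
  [tuple MN r; MN_relaxed r; MW r; whirl r].

(** * The Grassmann necklace is well defined *)

Section LexicographicMinimum.
Variables (d : Order.disp_t) (E : finOrderType d).

Lemma cyc_le_total (a : E) : total (cyc_le a).
Proof.
move=> x y; rewrite /cyc_le eq_sym; case: eqP => [_|]; first exact: le_total.
by case: (a <= x)%O; case: (a <= y)%O.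
Qed.

Lemma cyc_le_trans (a : E) : transitive (cyc_le a).
Proof.
move=> y x z; rewrite /cyc_le.
case: (a <= x)%O; case: (a <= y)%O; case: (a <= z)%O => //=; exact: le_trans.
Qed.

Lemma cyc_le_anti (a : E) : antisymmetric (cyc_le a).
Proof.
move=> x y; rewrite /cyc_le.
by case: (a <= x)%O; case: (a <= y)%O => //=; apply: le_anti.
Qed.

Lemma lexi_le_total (T : Type) (le : rel T) : total le -> total (lexi_le le).
Proof.
move=> tot; elim=> [|x s IH] [|y t] //=.
by case: (le x y) (le y x) (tot x y) => [] [] //=; case/orP: (IH t) => ->;
  rewrite ?orbT.
Qed.

Lemma lexi_le_trans (T : Type) (le : rel T) :
  transitive le -> transitive (lexi_le le).
Proof.
move=> tr; elim=> [|y t IH] [|x s] [|z u] //= /andP[xy /implyP h1].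
move=> /andP[yz /implyP h2]; rewrite (tr _ _ _ xy yz); apply/implyP => zx.
by apply: IH; [apply: h1; apply: tr zx | apply: h2; apply: tr xy].
Qed.

Lemma lexi_le_anti (T : Type) (le : rel T) :
  antisymmetric le -> antisymmetric (lexi_le le).
Proof.
move=> anti; elim=> [|x s IH] [|y t] //= /andP[/andP[xy h1] /andP[yx h2]].
have e : x = y by apply: anti; rewrite xy yx.
by move: h1 h2; rewrite xy yx /= => h1 h2; rewrite e (IH t) // h1 h2.
Qed.

Lemma set_lexi_le_anti (a : E) : antisymmetric (set_lexi_le a).
Proof.
move=> A B /(lexi_le_anti (@cyc_le_anti a)) e.
apply/setP => x; rewrite -(mem_enum A) -(mem_enum B).
by rewrite -(mem_sort (cyc_le a)) e mem_sort.
Qed.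

Lemma grassmann_necklaceP (M : matroid E) (a : E) (J : {set E}) :
  grassmann_necklace M a = J <->
  J \in bases M /\ forall B, B \in bases M -> set_lexi_le a J B.
Proof.
have tot : total (set_lexi_le a).
  by move=> A B; apply: lexi_le_total; apply: cyc_le_total.
have tr : transitive (set_lexi_le a).
  by move=> A B C; apply: lexi_le_trans; apply: cyc_le_trans.
rewrite /grassmann_necklace ffunE; case: pickP => [K /andP[KM /forall_inP Kmin] | no].
  split=> [<- //|[JM Jmin]] /=.
  by apply: (@set_lexi_le_anti a); rewrite Kmin // Jmin.
have /andP[/set0Pn[B0 B0M] _] := basesP M.
have refl : reflexive (set_lexi_le a) by move=> A; have := tot A A; rewrite orbb.
have [K KM Kmin] :=
  extremumP (P := fun B => B \in bases M) id refl tr tot B0M.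
by have /negP[] := no K; rewrite /= KM; apply/forall_inP.
Qed.

End LexicographicMinimum.

(* Main.v *)
Require Import Defs.
From mathcomp Require Import all_boot all_order all_algebra.
From mathcomp Require Import reals.
From mathcomp Require Import perm zify ring.

(* The Grassmann necklace of a matroid determines, and is determined by, the
   ranks of the cyclic intervals: the entry at [a] is the greedy basis, so it
   meets each initial segment of [cyc_le a] in as many elements as possible.

   In a whirl write T_i = {s_i, t_i, s_(i+1)} for the triangles, with spokes s_i
   and rim elements t_i.  By a three-term Pluecker relation a positroid has no
   circuit crossing a disjoint cocircuit; applied to the triangles and the vertex
   stars this makes the T_i consecutive, so for r >= 3 the order is
   s_0 t_0 s_1 t_1 ... up to rotation and reversal.

   A matroid X with the same ranks of intervals either has all spokes parallel or
   no two consecutive spokes parallel, since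
   r(E - {t_i, s_(i+1), t_(i+1)}) = r - 1 < r(E - t_i).  In the first case the
   bases other than the rim are the r-sets with exactly one spoke.  In the second
   case each T_i is a circuit, and two such matroids agree outside the rim: the
   span of a basis B other than the rim is closed under the triangles, and a proper
   set closed under the triangles and containing a spoke has rank less than r.  In
   both cases the rim may or may not be a basis. *)

Set Implicit Arguments.
Unset Strict Implicit.
Unset Printing Implicit Defensive.
Import Order.TTheory GRing.Theory Num.Theory.

(** * Rank and span in matroids, and the Grassmann necklace *)

(** The necklace sees only cyclic intervals, and this decides where [X] has freedom. The triangle
    T_i and the pairs {s_i, t_i}, {t_i, s_(i+1)} are intervals of rank 2, so in every [X] a spoke
    and the rim element of T_i span its other spoke. The pair {s_i, s_(i+1)} and the rim are not
    intervals, and their ranks are what may vary. Hence arguments common to all four matroids use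
    just two of the three closure rules of a triangle. These two rules already make every r-set with
    exactly one spoke a basis of every [X].

    The T_i become consecutive through overlapping stars: the stars of the vertices off T_i cover
    its complement and each shares a rim element with the next, so no two elements of T_i separate
    elements outside it. Then at most one element of T_i has its cyclic successor outside T_i. The
    rim element comes in the middle because a spoke in the middle would have three neighbours. *)

Section MatroidRank.
Variable E : finType.
Implicit Types (M : matroid E) (A B C I : {set E}).

Definition rank M A := \max_(B in bases M) #|A :&: B|.

Definition mspan M A := [set x | rank M (x |: A) == rank M A].

Lemma bases_nonempty M : exists B, B \in bases M.
Proof. by have /andP[/set0Pn] := basesP M. Qed.

Lemma exchange M A B x : A \in bases M -> B \in bases M -> x \in A -> x \notin B ->
  exists y, [/\ y \in B, y \notin A & y |: (A :\ x) \in bases M].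
Proof.
move=> AM BM xA xB; have /andP[_ /forall_inP/(_ A AM)/forall_inP/(_ B BM)] := basesP M.
move=> /forall_inP/(_ x); rewrite inE xA xB => /(_ isT)/exists_inP[y].
by rewrite inE => /andP[yA yB] yM; exists y.
Qed.

(** Elements of [A] outside [I :|: B] are exchanged one at a time for elements of [B]; the induction
    is on their number. *)
Lemma bases_extend M I A B : A \in bases M -> B \in bases M -> I \subset A ->
  exists C, [/\ C \in bases M, I \subset C & C \subset I :|: B].
Proof.
have [k] := ubnP #|A :\: (I :|: B)|; elim: k A => // k IH A lek AM BM sIA.
have [sA|/subsetPn[x xA]] := boolP (A \subset I :|: B); first by exists A.
rewrite inE negb_or => /andP[xI xB].
have [y [yB yA yM]] := exchange AM BM xA xB.
apply: (IH (y |: (A :\ x))) => //; last first.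
  apply/subsetP=> z zI; rewrite !inE (subsetP sIA) // andbT.
  by apply/orP; right; apply: contraNneq xI => <-.
have /proper_card : (y |: A :\ x) :\: (I :|: B) \proper A :\: (I :|: B).
  apply/properP; split.
    apply/subsetP=> z; rewrite !inE => /andP[zI /orP[/eqP zy|/andP[_ ->]]].
      by move: zI; rewrite zy yB orbT.
    by rewrite zI.
  exists x; rewrite !inE ?eqxx ?xA ?(negPf xI) ?(negPf xB) //=.
  by rewrite orbF; apply: contraNneq yA => <-.
lia.
Qed.

Lemma subset_bases M A B : A \in bases M -> B \in bases M -> A \subset B -> A = B.
Proof.
move=> AM BM sAB; apply/eqP; rewrite eqEsubset sAB; apply/subsetP=> x xB.
apply: contraT => xA; have [y [yA yB _]] := exchange BM AM xB xA.
by rewrite (subsetP sAB) in yB.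
Qed.

Lemma card_bases M A B : A \in bases M -> B \in bases M -> #|A| = #|B|.
Proof.
have [k] := ubnP #|A :\: B|; elim: k A => // k IH A lek AM BM.
have [sA|/subsetPn[x xA xB]] := boolP (A \subset B); first by rewrite (subset_bases AM BM).
have [y [yB yA yM]] := exchange AM BM xA xB.
have cA : #|y |: (A :\ x)| = #|A|.
  by rewrite cardsU1 !inE (negPf yA) andbF [#|A|](cardsD1 x) xA.
rewrite -cA; apply: IH => //.
have /proper_card : (y |: A :\ x) :\: B \proper A :\: B.
  apply/properP; split.
    apply/subsetP=> z; rewrite !inE => /andP[zI /orP[/eqP zy|/andP[_ ->]]].
      by move: zI; rewrite zy yB.
    by rewrite zI.
  exists x; rewrite !inE ?eqxx ?xA ?(negPf xB) //=.
  by rewrite orbF; apply: contraNneq yA => <-.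
lia.
Qed.

Lemma rank_attained M A : exists2 B, B \in bases M & #|A :&: B| = rank M A.
Proof.
have [B0 B0M] := bases_nonempty M.
have [|B BM e] := @eq_bigmax_cond _ (mem (bases M)) (fun B => #|A :&: B|).
  by apply/card_gt0P; exists B0.
by exists B => //; rewrite /rank e.
Qed.

Lemma card_le_rank M A B : B \in bases M -> #|A :&: B| <= rank M A.
Proof. by move=> BM; apply: (@leq_bigmax_cond _ _ (fun B => #|A :&: B|)). Qed.

(** Extending [A :&: B] from a basis [D] optimal for [A'] keeps the optimum on [A], and [C :\: A']
    lies in [D :\: A'], so [C] is optimal on [A'] too. For submodularity this gives one basis that
    counts both the intersection and the union. *)
Lemma rank_attained_extend M A A' B : B \in bases M -> #|A :&: B| = rank M A ->
  A \subset A' ->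
  exists C, [/\ C \in bases M, #|A :&: C| = rank M A & #|A' :&: C| = rank M A'].
Proof.
move=> BM rB sAA'; have [D DM rD] := rank_attained M A'.
have [C [CM sC Csub]] := @bases_extend M (A :&: B) B D BM DM (subsetIr _ _).
have h1 : #|A :&: B| <= #|A :&: C| by rewrite subset_leq_card // subsetI subsetIl.
have h2 := card_le_rank A CM; have h3 := card_le_rank A' CM.
have h4 : #|C :\: A'| <= #|D :\: A'|.
  apply: subset_leq_card; apply/subsetP=> x; rewrite !inE => /andP[xA' /(subsetP Csub)].
  by rewrite !inE xA' => /orP[/andP[/(subsetP sAA')]|//]; rewrite (negPf xA').
have h5 := cardsID A' C; have h6 := cardsID A' D; have h7 := card_bases CM DM.
by exists C; split=> //; move: h5 h6; rewrite ![_ :&: A']setIC; lia.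
Qed.

Lemma rank_submod M A B :
  rank M (A :|: B) + rank M (A :&: B) <= rank M A + rank M B.
Proof.
have [C0 C0M r0] := rank_attained M (A :&: B).
have [|C [CM r1 r2]] := @rank_attained_extend M _ (A :|: B) C0 C0M r0.
  by rewrite subIset // subsetUl.
rewrite -r1 -r2 setIUl.
have -> : A :&: B :&: C = (A :&: C) :&: (B :&: C) by rewrite setIACA setIid.
by rewrite cardsUI leq_add // card_le_rank.
Qed.

Lemma rank_mono M A B : A \subset B -> rank M A <= rank M B.
Proof.
move=> sAB; have [C CM <-] := rank_attained M A.
by apply: leq_trans (card_le_rank B CM); rewrite subset_leq_card // setSI.
Qed.

Lemma rank_le_card M A : rank M A <= #|A|.
Proof. by have [C CM <-] := rank_attained M A; rewrite subset_leq_card // subsetIl. Qed.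

Lemma rankU M A B : rank M (A :|: B) <= rank M A + #|B|.
Proof. have := rank_submod M A B; have := rank_le_card M B; lia. Qed.

Lemma rankU1 M A x : rank M (x |: A) <= (rank M A).+1.
Proof. by have := rankU M A [set x]; rewrite setUC cards1 addn1. Qed.

Lemma rank_basis M B : B \in bases M -> rank M B = #|B|.
Proof. by move=> BM; apply/eqP; rewrite eqn_leq rank_le_card -{1}(setIid B) card_le_rank. Qed.

Lemma rank_le_basis M A B : B \in bases M -> rank M A <= #|B|.
Proof.
move=> BM; have [C CM <-] := rank_attained M A.
by rewrite (card_bases BM CM) subset_leq_card // subsetIr.
Qed.

Lemma basis_of_rank M A B : B \in bases M -> #|A| = #|B| -> #|B| <= rank M A ->
  A \in bases M.
Proof.
move=> BM cA; have [C CM <-] := rank_attained M A => le.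
have cCB := card_bases BM CM.
have eA : A :&: C = A by apply/eqP; rewrite eqEcard subsetIl cA.
have eC : A :&: C = C by apply/eqP; rewrite eqEcard subsetIr -cCB.
by rewrite -eA eC.
Qed.

Lemma rank_indep M A B : B \in bases M -> A \subset B -> rank M A = #|A|.
Proof.
move=> BM sAB; apply/eqP; rewrite eqn_leq rank_le_card.
by have := card_le_rank A BM; rewrite (setIidPl sAB).
Qed.

Lemma indep_of_rank M A : rank M A = #|A| -> exists2 B, B \in bases M & A \subset B.
Proof.
have [C CM <-] := rank_attained M A => e; exists C => //.
by rewrite -[A](_ : A :&: C = A) ?subsetIr //; apply/eqP; rewrite eqEcard subsetIl e leqnn.
Qed.

Lemma mem_mspan M A x : x \in A -> x \in mspan M A.
Proof. by move=> xA; rewrite inE (setUidPr _) // sub1set. Qed.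

Lemma sub_mspan M A : A \subset mspan M A.
Proof. by apply/subsetP=> x; apply: mem_mspan. Qed.

Lemma rank_span M A : rank M (mspan M A) = rank M A.
Proof.
apply/eqP; rewrite eqn_leq (rank_mono M (sub_mspan M A)) andbT.
suff h (l : seq E) : {subset l <= mspan M A} -> rank M ([set x in l] :|: A) <= rank M A.
  apply: leq_trans (h (enum (mspan M A)) _); last by move=> x; rewrite mem_enum.
  by apply: rank_mono; apply/subsetP=> x xs; rewrite !inE mem_enum xs.
elim: l => [|x l IH] sl; first by apply: rank_mono; apply/subsetP=> y; rewrite !inE.
have {}IH := IH (fun y yl => sl y (mem_behead (s := x :: l) yl)).
have /[!inE]/eqP xA := sl x (mem_head x l).
have := rank_submod M (x |: A) ([set y in l] :|: A).
have : rank M A <= rank M ((x |: A) :&: ([set y in l] :|: A)).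
  by apply: rank_mono; rewrite subsetI !subsetUr.
rewrite (_ : (x |: A) :|: ([set y in l] :|: A) = [set y in x :: l] :|: A); first by lia.
by apply/setP=> y; rewrite !inE; do ?case: (_ \in _); rewrite ?orbT ?orbF.
Qed.

Lemma rank_sub_span M A B : B \subset mspan M A -> rank M B <= rank M A.
Proof. by move=> /(rank_mono M); rewrite rank_span. Qed.

Lemma mspan_sub M A B : A \subset mspan M B -> mspan M A \subset mspan M B.
Proof.
move=> sAB; apply/subsetP=> x /[!inE] /eqP xA.
have e : rank M (A :|: B) = rank M B.
  apply/eqP; rewrite eqn_leq (rank_mono M (subsetUr A B)) andbT.
  by apply: rank_sub_span; rewrite subUset sAB sub_mspan.
rewrite eqn_leq (rank_mono M (subsetUr _ B)) andbT.
have := rank_submod M (x |: A) (A :|: B).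
have : rank M A <= rank M ((x |: A) :&: (A :|: B)).
  by apply: rank_mono; rewrite subsetI subsetUr subsetUl.
have : rank M (x |: B) <= rank M ((x |: A) :|: (A :|: B)).
  by apply: rank_mono; apply/subsetP=> y; rewrite !inE => /orP[] ->; rewrite ?orbT.
lia.
Qed.

Lemma span_closed M A B x : x \in mspan M A -> A \subset mspan M B -> x \in mspan M B.
Proof. by move=> xA /mspan_sub/subsetP; apply. Qed.

Lemma span_of_rank M A C x : A \subset C -> x \in C -> rank M C <= rank M A ->
  x \in mspan M A.
Proof.
move=> sAC xC le; rewrite inE eqn_leq (rank_mono M (subsetUr _ A)) andbT.
by apply: leq_trans le; apply: rank_mono; rewrite subUset sub1set xC.
Qed.

Lemma card_lt_witness (I J B C : {set E}) : #|C| = #|B| -> C \subset (I :&: J) :|: B ->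
  #|I :&: J| < #|I :&: B| -> exists x, x \in (I :&: C) :\: J.
Proof.
move=> cCB Csub lt; apply/set0Pn; rewrite setD_eq0; apply/negP=> sCJ.
have : #|C :\: I| <= #|B :\: I|.
  apply: subset_leq_card; apply/subsetP=> z; rewrite !inE => /andP[zI /(subsetP Csub)].
  by rewrite !inE (negPf zI).
have : #|I :&: C| <= #|I :&: J| by rewrite subset_leq_card // subsetI subsetIl.
have := cardsID I C; have := cardsID I B; rewrite cCB (setIC C) (setIC B); lia.
Qed.

End MatroidRank.

(** * The necklace and the ranks of cyclic intervals *)

Section Necklace.
Variables (d : Order.disp_t) (E : finOrderType d).
Implicit Types (M : matroid E) (A B J : {set E}).

(** At the first difference [t] has [x], while [s], being as long as [t], has an entry after [x]. A
    shorter [s] could end there and be smaller. *)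
Lemma lexi_leF (T : eqType) (le : rel T) (s t : seq T) x :
    transitive le -> antisymmetric le -> sorted le s -> sorted le t ->
    uniq s -> uniq t -> size s = size t -> x \in t -> x \notin s ->
    (forall w, w != x -> le w x -> (w \in s) = (w \in t)) ->
  lexi_le le s t = false.
Proof.
move=> tr anti; elim: t s => [|v t IH] [|u s] //= ps pt /andP[us Us] /andP[vt Ut] [sz].
move=> xt xs agree; apply/negbTE/negP=> /andP[leuv /implyP rest].
have su := allP (order_path_min tr ps); have tv := allP (order_path_min tr pt).
have ux : u != x by apply: contraNneq xs => ->; rewrite mem_head.
have vx : v != x.
  apply/eqP=> vx; have := agree u ux; rewrite -vx leuv mem_head inE => /(_ isT)/esym.
  rewrite {1}vx (negPf ux) /= => /tv levu.
  by move/eqP: ux; apply; rewrite -vx; apply: anti; rewrite leuv.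
have xt' : x \in t by move: xt; rewrite inE eq_sym (negPf vx).
have levx := tv _ xt'; have leux := tr _ _ _ leuv levx.
have uv : u = v.
  have := agree u ux leux; rewrite mem_head inE => /esym/orP[/eqP//|/tv levu].
  by apply: anti; rewrite leuv.
subst v; suff: lexi_le le s t = false by rewrite rest.
apply: IH => //; [exact: path_sorted ps|exact: path_sorted pt| |].
  by move: xs; rewrite inE negb_or => /andP[].
move=> w wx lewx; have := agree w wx lewx; rewrite !inE.
by have [->|] := eqVneq w u; rewrite ?(negPf us) ?(negPf vt).
Qed.

Definition cyc_interval (a b : E) : {set E} := [set x | cyc_le a x b].

Lemma cyc_le_refl (a : E) : reflexive (cyc_le a).
Proof. by move=> x; have := cyc_le_total a x x; rewrite orbb. Qed.

(** Otherwise replacing [y] by the earlier [x] would give a lexicographically smaller basis. *)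
Lemma necklace_exchange M a x y (J := grassmann_necklace M a) :
  x \notin J -> y \in J -> x |: (J :\ y) \in bases M -> cyc_le a y x.
Proof.
have [JM Jmin] := (grassmann_necklaceP M a J).1 erefl => xJ yJ J'M.
have /orP[//|lexy] := cyc_le_total a y x.
have := Jmin _ J'M; rewrite /set_lexi_le (@lexi_leF _ _ _ _ x) //.
- exact: cyc_le_trans.
- exact: cyc_le_anti.
- exact/sort_sorted/cyc_le_total.
- exact/sort_sorted/cyc_le_total.
- by rewrite sort_uniq enum_uniq.
- by rewrite sort_uniq enum_uniq.
- by rewrite !size_sort -!cardE (card_bases JM J'M).
- by rewrite mem_sort mem_enum !inE eqxx.
- by rewrite mem_sort mem_enum.
move=> w wx lewx; rewrite !mem_sort !mem_enum !inE (negPf wx) /=.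
have [wy|//] := eqVneq w y; move: lewx; rewrite wy => leyx.
by case/eqP: wx; rewrite wy; apply: (@cyc_le_anti _ _ a); rewrite leyx.
Qed.

(** The greedy property. If a basis met [I] in more elements, [I :&: J] with a further [x] of [I]
    would be independent. Completing it from [J] replaces a single [y] outside [I] by [x], and [x]
    comes before [y], against minimality. *)
Lemma necklace_rank M a b (I := cyc_interval a b) (J := grassmann_necklace M a) :
  #|I :&: J| = rank M I.
Proof.
have [JM _] := (grassmann_necklaceP M a J).1 erefl.
have ex := @necklace_exchange M a; rewrite -/J in ex.
have memI z : (z \in I) = cyc_le a z b by rewrite inE.
clearbody I J.
apply/eqP; rewrite eqn_leq card_le_rank //=; have [B BM <-] := rank_attained M I.
rewrite leqNgt; apply/negP=> lt.
have [C [CM sC Csub]] := bases_extend JM BM (subsetIr I J).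
have [x /[!inE]] := card_lt_witness (card_bases CM BM) Csub lt.
case/and3P=> [xJ xI xC].
have sxC : x |: (I :&: J) \subset C by rewrite subUset sub1set xC.
have [D [DM sD Dsub]] := bases_extend CM JM sxC.
have xD : x \in D by rewrite (subsetP sD) // setU11.
have [y yJ yD] : exists2 y, y \in J & y \notin D.
  apply/subsetPn/negP=> sJD; by rewrite (subset_bases JM DM sJD) xD in xJ.
have yI : y \notin I.
  by apply: contra yD => yI; rewrite (subsetP sD) // !inE yJ yI orbT.
have eD : D = x |: (J :\ y).
  apply/eqP; rewrite eqEcard cardsU1 !inE (negPf xJ) andbF (card_bases DM JM).
  rewrite (cardsD1 y J) yJ leqnn andbT; apply/subsetP=> z zD.
  rewrite !inE; have /[!inE] := subsetP Dsub z zD.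
  have [//|_ /=] := eqVneq z x; rewrite (_ : z != y) /=; last by apply: contraNneq yD => <-.
  by case/orP=> // /andP[].
have := ex x y xJ yJ; rewrite -eD => /(_ DM) leyx.
by move: yI xI; rewrite !memI => /negP nle lexb; case: nle; apply: cyc_le_trans lexb.
Qed.

(* A set is recovered from the sizes of its intersections with the initial
   segments of a linear order. *)
Lemma envelope_rankP M P : (M \in positroid_envelope P) <->
  forall a b, rank M (cyc_interval a b) = rank P (cyc_interval a b).
Proof.
rewrite inE; split=> [/eqP e a b|e]; first by rewrite -!necklace_rank e.
apply/eqP/ffunP=> a; set J := grassmann_necklace M a; set K := grassmann_necklace P a.
have agree b : #|cyc_interval a b :&: J| = #|cyc_interval a b :&: K|.
  by rewrite !necklace_rank.
suff h k x : #|cyc_interval a x| < k -> (x \in J) = (x \in K).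
  by apply/setP=> x; apply: h (leqnn _).
elim: k x => // k IH x lek; have := agree x.
rewrite (cardsD1 x) [RHS](cardsD1 x) !in_setI (_ : x \in _) /=; last first.
  by rewrite inE cyc_le_refl.
rewrite (_ : (cyc_interval a x :&: J) :\ x = (cyc_interval a x :&: K) :\ x); last first.
  apply/setP=> y; rewrite !in_setD1 !in_setI.
  have [//|yx /=] := eqVneq y x; have [yI /=|//] := boolP (y \in _).
  have lyx : cyc_le a y x by move: yI; rewrite inE.
  apply: IH; apply: leq_trans (_ : #|cyc_interval a y| < #|cyc_interval a x|) _; last by lia.
  apply: proper_card; apply/properP; split.
    by apply/subsetP=> z; rewrite !inE => zy; apply: cyc_le_trans lyx.
  exists x; rewrite !inE ?cyc_le_refl //; apply: contra yx => lxy.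
  by apply/eqP/(@cyc_le_anti _ _ a); rewrite lyx.
by case: (x \in J) (x \in K) => [] [] //=; lia.
Qed.

End Necklace.

(** * Positroids are non-crossing *)

Lemma card_add2 (T : finType) (x y : T) (K : {set T}) : #|x |: (y |: K)| = #|K|.+2 ->
  [/\ x != y, x \notin K & y \notin K].
Proof.
by rewrite !cardsU1 !inE; case: eqP; case: (x \in K); case: (y \in K);
  rewrite /= ?addn0 ?add0n ?add1n => //; lia.
Qed.

Section Positroid.
Local Open Scope ring_scope.

Section Minors.
Variable R : realType.

Definition vdm n k (g : 'I_k -> 'I_n) : R :=
  \prod_(i < k) \prod_(j < k | (i < j)%N) ((g j)%:R - (g i)%:R).

(** As a minor of a Vandermonde matrix, [vdm] changes by the same sign as any other maximal minor
    when columns are permuted. *)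
Lemma vdmE n k (g : 'I_k -> 'I_n) :
  vdm g = \det (colsub g (Vandermonde k (\row_j (j : nat)%:R))).
Proof.
rewrite (_ : colsub _ _ = Vandermonde k (\row_j (g j : nat)%:R)); last first.
  by apply/matrixP=> i j; rewrite !mxE.
rewrite det_Vandermonde; apply: eq_bigr => i _; apply: eq_bigr => j _.
by rewrite !mxE.
Qed.

Lemma vdm_gt0 n k (g : 'I_k -> 'I_n) : {homo g : i j / (i < j)%N} -> 0 < vdm g.
Proof.
move=> mono; apply: prodr_gt0 => i _; apply: prodr_gt0 => j ij.
by rewrite subr_gt0 ltr_nat mono.
Qed.

Lemma sort_injection n k (g : 'I_k -> 'I_n) : injective g ->
  exists (s : 'S_k) (f : 'I_k -> 'I_n),
    {homo f : i j / (i < j)%N} /\ g =1 f \o s.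
Proof.
move=> ginj; pose le := relpre (@nat_of_ord n) leq.
have le_tr : transitive le by move=> ? ? ?; apply: leq_trans.
pose l := sort_tuple le [tuple g i | i < k].
have /tuple_permP[s es] : perm_eq [tuple g i | i < k] l.
  by rewrite perm_sym perm_sort.
exists s, (tnth l); split=> [i j ij|i]; last first.
  have -> : g i = tnth [tuple g i | i < k] i by rewrite tnth_mktuple.
  have {1}-> : [tuple g i | i < k] = [tuple tnth l (s i) | i < k] by apply: val_inj.
  by rewrite tnth_mktuple.
have ul : uniq l.
  by rewrite sort_uniq map_inj_uniq ?enum_uniq.
have sl : sorted le l by apply: sort_sorted => x y; apply: leq_total.
have := @sorted_leq_nth _ le le_tr (fun _ => leqnn _) (g i) l sl i j.
rewrite !inE size_tuple !ltn_ord => /(_ isT isT (ltnW ij)).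
rewrite -!tnth_nth ltn_neqAle => leij; rewrite (leij : (tnth l i <= tnth l j)%N) andbT.
apply/eqP=> /val_inj; rewrite !(tnth_nth (g i)) => /eqP.
by rewrite nth_uniq ?size_tuple ?ltn_ord // => /eqP e; rewrite e ltnn in ij.
Qed.

Lemma det_vdm_sorted n k (A : 'M[R]_(k, n)) (f : 'I_k -> 'I_n) (s : 'S_k) g :
  g =1 f \o s -> \det (colsub g A) = (-1) ^+ s * \det (colsub f A).
Proof.
move=> e; rewrite (_ : colsub g A = col_perm s (colsub f A)); last first.
  by apply/matrixP=> i j; rewrite !mxE e.
by rewrite col_permE det_mulmx det_perm odd_permV mulrC.
Qed.

End Minors.

Variables (R : realType) (d : Order.disp_t) (E : finOrderType d) (P : matroid E).

(* Multiplying a minor by the Vandermonde product of its column indices makes its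
   sign independent of the order of the columns. *)
Lemma positroid_minors : positroid R P ->
  exists (k : nat) (A : 'M[R]_(k, #|E|)), (forall B, B \in bases P -> #|B| = k) /\
    forall g : 'I_k -> 'I_#|E|, injective g ->
    [/\ vdm R g != 0, 0 <= \det (colsub g A) * vdm R g &
    ([set Order.enum_val (g i) | i : 'I_k] \in bases P) = (\det (colsub g A) != 0)].
Proof.
case=> k [A [_ nonneg basP]]; exists k, A.
have inc_inj (f : 'I_k -> 'I_#|E|) : {homo f : i j / (i < j)%N} -> injective f.
  by move=> fmono i j fij; apply/val_inj; case: (ltngtP i j) => // /fmono; rewrite fij ltnn.
split=> [B /basP[f [fmono -> _]]|g /sort_injection[s [f [fmono gE]]]].
  rewrite card_imset ?card_ord // => i j /Order.enum_val_inj; exact: inc_inj.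
have eS : [set Order.enum_val (g i) | i : 'I_k] = [set Order.enum_val (f i) | i : 'I_k].
  apply/setP=> x; apply/imsetP/imsetP=> -[i _ ->]; first by exists (s i); rewrite // gE.
  by exists (s^-1%g i); rewrite // gE /= permKV.
rewrite vdmE !(det_vdm_sorted _ gE) -vdmE eS mulrACA -signr_addb addbb mul1r.
split; [by rewrite mulf_neq0 ?signr_eq0 // gt_eqF ?vdm_gt0|
  by rewrite mulr_ge0 ?nonneg // ltW ?vdm_gt0|].
rewrite mulf_eq0 signr_eq0 /=; apply/idP/idP=> [/basP[h [hmono]]|nz]; last first.
  by apply/basP; exists f.
(* The basis may be witnessed by another increasing choice [h]; having the same image, [f] and [h]
   differ by a permutation, so their minors vanish together. *)
move=> eim; have fh i : exists j, f i == h j.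
  have : Order.enum_val (f i) \in [set Order.enum_val (f i) | i : 'I_k].
    by apply/imsetP; exists i.
  by rewrite eim => /imsetP[j _ /Order.enum_val_inj/eqP ?]; exists j.
have finj := inc_inj f fmono.
pose p i := xchoose (fh i); have fp i : f i = h (p i) by apply/eqP; exact: (xchooseP (fh i)).
have pinj : injective p by move=> i j pij; apply: finj; rewrite !fp pij.
rewrite (@det_vdm_sorted _ _ _ A h (perm pinj) f); last by move=> i; rewrite /= permE fp.
by rewrite mulf_eq0 signr_eq0.
Qed.

(* Modulo the span of the columns [A_K] the columns [A_a] and [A_c] are parallel,
   so the functionals [det (_, A_b, A_K)] and [det (_, A_d, A_K)] take proportional
   values on them. *)
Lemma det_parallel (F : fieldType) n m (A : 'M[F]_(m.+2, n)) (K : m.-tuple 'I_n)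
    (h := fun x y => \det (colsub (tnth [tuple of x :: y :: K]) A)) a b c e :
  h a c = 0 -> h a b * h c e = h c b * h a e.
Proof.
move=> hac; pose C x y := colsub (tnth [tuple of x :: y :: K]) A.
(* Laplace expansion along the first column: [N y] is the functional [det (_, A_y, A_K)]. *)
pose N y : 'rV[F]_m.+2 := \row_i cofactor (C a y) i ord0.
have hN x y : h x y = (N y *m col x A) 0 0.
  rewrite /h (expand_det_col _ ord0) mxE; apply: eq_bigr => i _.
  rewrite !mxE mulrC /cofactor; congr (_ * \det _ * _).
  apply/matrixP=> p q; rewrite !mxE.
  by rewrite !(tnth_nth a).
have hK k y : h (tnth K k) y = 0.
  rewrite /h -det_tr.
  apply: (@determinant_alternate _ _ _ ord0 (lift ord0 (lift ord0 k))) => // j.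
  by rewrite !mxE !(tnth_nth a).
have /det0P[v v0 vC] : \det (C a c)^T == 0 by rewrite det_tr; apply/eqP.
have vE x y : (v *m (C x y)^T == 0) = (C x y *m v^T == 0).
  by rewrite -[v in LHS]trmxK -trmx_mul trmx_eq0.
pose i1 : 'I_m.+2 := lift ord0 ord0.
(* A dependency supported on [K] kills every [h x y]; otherwise one of the two leading coefficients
   is nonzero and is cancelled at the end. *)
have [/andP[/eqP z0 /eqP z1]|nz] := boolP ((v 0 ord0 == 0) && (v 0 i1 == 0)).
  suff h0 x y : h x y = 0 by rewrite !h0 !mul0r.
  apply/eqP; rewrite /h -det_tr; apply/det0P; exists v => //; rewrite -vC.
  apply/matrixP=> i j; rewrite !mxE !big_ord_recl.
  by rewrite !(ord1 i) z0 z1 !mul0r !add0r; apply: eq_bigr => k _; rewrite !mxE !(tnth_nth a).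
(* The functional [N y] applied to the dependency of the columns [a], [c], [K]; the terms from [K]
   vanish. *)
have dep y : v 0 ord0 * h a y + v 0 i1 * h c y = 0.
  have : (N y *m (C a c *m v^T)) 0 0 = 0.
    by have /eqP := vC; rewrite vE => /eqP ->; rewrite mulmx0 mxE.
  rewrite mulmxA mxE !big_ord_recl big1 ?addr0.
    move=> eN; rewrite -[RHS]eN !hN !mxE; congr (_ + _); rewrite mulrC; congr (_ * _);
      by apply: eq_bigr => i _; rewrite !mxE.
  move=> k _; suff -> : (N y *m C a c) 0 (lift ord0 (lift ord0 k)) = 0 by rewrite mul0r.
  rewrite -[RHS](hK k y) hN !mxE.
  by apply: eq_bigr => i _; rewrite !mxE !(tnth_nth a).
have db := dep b; have de := dep e.
have e0 : v 0 ord0 * (h a b * h c e - h c b * h a e) = 0.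
  transitivity ((v 0 ord0 * h a b + v 0 i1 * h c b) * h c e
    - h c b * (v 0 ord0 * h a e + v 0 i1 * h c e)); first by ring.
  by rewrite db de mul0r mulr0 subr0.
have e1 : v 0 i1 * (h a b * h c e - h c b * h a e) = 0.
  transitivity (h a b * (v 0 ord0 * h a e + v 0 i1 * h c e)
    - h a e * (v 0 ord0 * h a b + v 0 i1 * h c b)); first by ring.
  by rewrite db de !mulr0 subr0.
by move: nz; apply: contraNeq; rewrite -subr_eq0 => ne; move/eqP: e0; move/eqP: e1;
  rewrite !mulf_eq0 (negPf ne) !orbF => -> ->.
Qed.

Lemma vdm_recl n m (g : 'I_m.+1 -> 'I_n) :
  vdm R g = \prod_(k < m) ((g (lift ord0 k))%:R - (g ord0)%:R) * vdm R (g \o lift ord0).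
Proof.
rewrite /vdm big_ord_recl; congr (_ * _).
  by rewrite big_mkcond big_ord_recl ltnn /= mul1r; apply: eq_bigr.
apply: eq_bigr => i _; rewrite big_mkcond big_ord_recl ltn0 /= mul1r [RHS]big_mkcond.
by apply: eq_bigr => j _; rewrite /= /bump /= !add1n ltnS.
Qed.

(** All factors but [y%:R - x%:R] split into parts from [x], from [y] and from [K], so they occur to
    even powers in a product over the pairs ab, ce, cb, ae. *)
Lemma vdm_cons n m (K : m.-tuple 'I_n) (x y : 'I_n) :
  vdm R (tnth [tuple of x :: y :: K]) =
   (y%:R - x%:R) * ((\prod_(k < m) ((tnth K k)%:R - x%:R)) *
     (\prod_(k < m) ((tnth K k)%:R - y%:R)) * vdm R (tnth K)).
Proof.
rewrite !vdm_recl big_ord_recl -!mulrA; congr (_ * (_ * (_ * _))).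
- by apply: eq_bigr => k _; rewrite !(tnth_nth x).
- by apply: eq_bigr => k _; rewrite /= !(tnth_nth x).
apply: eq_bigr => i _; apply: eq_bigr => j _; by rewrite /= !(tnth_nth x).
Qed.

Lemma lt_enum_rank (x y : E) :
  (x < y)%O = (Order.enum_rank x < Order.enum_rank y)%N.
Proof.
rewrite ltNge ltnNge; congr (~~ _).
exact/esym/(Order.EnumVal.le_enum_rank (@le_total _ E)).
Qed.

(** With [h a c = 0] the Pluecker relation reads [h a b * h c e = h c b * h a e], so all four minors
    are nonzero and their weighted versions positive. In the product of these everything except the
    four differences of positions is a square, so an even number of the differences is negative. In
    the application [a], [c] come from a circuit and [b], [e] from a cocircuit. *)
Lemma positroid_noncrossing (K : {set E}) a b c e : positroid R P ->
  (forall B, B \in bases P -> #|B| = #|K|.+2) ->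
  a |: (c |: K) \notin bases P -> a |: (b |: K) \in bases P -> c |: (e |: K) \in bases P ->
  (a < b)%O (+) (c < b)%O = (a < e)%O (+) (c < e)%O.
Proof.
move=> posP cardP acK abK ceK.
have new x y : x |: (y |: K) \in bases P -> [/\ x != y, x \notin K & y \notin K].
  by move=> /cardP/card_add2.
have [ab aK bK] := new a b abK; have [ce cK eK] := new c e ceK.
have [->|ac] := eqVneq a c; first by rewrite !addbb.
have cb : c != b by apply: contraNneq acK => ->.
have ae : a != e by apply: contraNneq acK => ->; rewrite setUCA.
have [k [A [cardk minorP]]] := positroid_minors posP.
have ek : k = #|K|.+2 by rewrite -(cardk _ abK) (cardP _ abK).
subst k.
pose L := map_tuple (@Order.enum_rank _ E) (enum_tuple (mem K)).
pose g x y := tnth [tuple of Order.enum_rank x :: Order.enum_rank y :: L].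
have memL x : (Order.enum_rank x \in L) = (x \in K).
  by rewrite mem_map ?mem_enum //; apply: Order.EnumVal.enum_rank_inj.
have ginj x y : x != y -> x \notin K -> y \notin K -> injective (g x y).
  move=> xy xK yK; apply/tuple_uniqP; rewrite /= inE negb_or !memL xK yK.
  rewrite (inj_eq (@Order.EnumVal.enum_rank_inj _ _)) xy.
  by rewrite map_inj_uniq ?enum_uniq //; apply: Order.EnumVal.enum_rank_inj.
have gset x y : [set Order.enum_val (g x y i) | i : 'I_#|K|.+2] = x |: (y |: K).
  apply/setP=> z; rewrite !inE -memL -!(inj_eq (@Order.EnumVal.enum_rank_inj _ _) z).
  rewrite -[_ || _]/(Order.enum_rank z \in [tuple of Order.enum_rank x :: Order.enum_rank y
    :: L]).
  apply/imsetP/tnthP=> [[i _ ->]|[i zi]]; exists i => //.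
    by rewrite Order.EnumVal.enum_valK.
  by rewrite -[g x y i]zi Order.EnumVal.enum_rankK.
pose h x y := \det (colsub (g x y) A).
have hP x y : x != y -> x \notin K -> y \notin K ->
    [/\ vdm R (g x y) != 0, 0 <= h x y * vdm R (g x y) & (x |: (y |: K) \in bases P) = (h x
      y != 0)].
  by move=> xy xK yK; rewrite -gset; apply: minorP; apply: ginj.
have [_ _ /esym] := hP a c ac aK cK; rewrite (negPf acK) => /negbFE/eqP hac.
have := det_parallel (Order.enum_rank b) (Order.enum_rank e) hac.
rewrite -![\det _]/(h _ _) => heq.
have [v1 p1 /esym] := hP a b ab aK bK; rewrite abK => n1.
have [v2 p2 /esym] := hP c e ce cK eK; rewrite ceK => n2.
have [v3 p3 _] := hP c b cb cK bK; have [v4 p4 _] := hP a e ae aK eK.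
have : h a b * h c e != 0 by rewrite mulf_neq0.
rewrite heq mulf_eq0 negb_or => /andP[n3 n4].
have : 0 < (h a b * vdm R (g a b) * (h c e * vdm R (g c e))) *
           (h c b * vdm R (g c b) * (h a e * vdm R (g a e))).
  have gt0 (x y : R) : x != 0 -> y != 0 -> 0 <= x * y -> 0 < x * y.
    by move=> x0 y0; rewrite le0r mulf_eq0 (negPf x0) (negPf y0).
  apply: mulr_gt0; apply: mulr_gt0; exact: gt0.
pose w (x : E) : R := \prod_(k < #|K|) ((tnth L k)%:R - (Order.enum_rank x)%:R).
pose del (x y : E) : R := (Order.enum_rank y)%:R - (Order.enum_rank x)%:R.
have VE x y : vdm R (g x y) = del x y * (w x * w y * vdm R (tnth L)) by apply: vdm_cons.
rewrite !VE; move: (w a) (w b) (w c) (w e) (vdm R (tnth L)) => wa wb wc we v.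
rewrite [X in 0 < X -> _](_ : _ = del a b * del c e * (del c b * del a e) *
    (h a b * h c e * (wa * wb * wc * we * v ^+ 2)) ^+ 2); last first.
  rewrite exprMn [in RHS](_ : (h a b * h c e) ^+ 2 = h a b * h c e * (h c b * h a e)).
    by ring.
  by rewrite -heq expr2.
move: (h a b * _ * _) => Y pos.
have {}pos : 0 < del a b * del c e * (del c b * del a e).
  rewrite ltNge; apply: contraTN pos => neg.
  by rewrite -real_leNgt ?num_real // mulr_le0_ge0 // sqr_ge0.
have cmp (x y : E) : x != y -> (x < y)%O = ~~ (y < x)%O.
  by move=> xy; rewrite ltNge le_eqVlt eq_sym (negPf xy).
have sgd (x y : E) : x != y -> Num.sg (del x y) = (-1) ^+ ~~ (x < y)%O.
  move=> xy; rewrite -neqr0_sign ?subr_lt0 ?ltr_nat -?lt_enum_rank.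
    by rewrite (cmp x y xy) negbK.
  rewrite subr_eq0 eqr_nat (inj_eq val_inj) eq_sym.
  by rewrite (inj_eq (@Order.EnumVal.enum_rank_inj _ _)).
have := gtr0_sg pos; rewrite !sgrM !sgd // -!signr_addb.
have -> (z : bool) : ((-1) ^+ z = 1 :> R) <-> z = false.
  case: z => /=; split=> // /eqP; rewrite ?expr1 ?eqNr ?oner_eq0 //.
by case: (a < b)%O; case: (c < e)%O; case: (c < b)%O; case: (a < e)%O.
Qed.

End Positroid.

(** * Cycles in wheels and in N_r *)

Section Cycles.
Variables (V E : finType) (G : multigraph V E).

Definition incident (v : V) (e : E) := (v == (G e).1) || (v == (G e).2).

Lemma joins_incident e u v : joins G e u v -> incident u e /\ incident v e.
Proof.
by rewrite /joins /incident => /orP[] /eqP -> /=; rewrite !eqxx ?orbT.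
Qed.

Lemma incident_joins e u v w : joins G e u v -> incident w e -> w = u \/ w = v.
Proof.
rewrite /joins /incident => /orP[] /eqP -> /= /orP[] /eqP ->; by [left | right].
Qed.

Lemma is_cycle_seq (s : seq (V * E)) : s != [::] -> uniq (unzip1 s) -> uniq (unzip2 s) ->
  cycle (fun p q => joins G p.2 p.1 q.1) s -> is_cycle G [set e in unzip2 s].
Proof.
move=> s0 u1 u2 cs; apply/andP; split.
  case: s s0 {u1 u2 cs} => // p s _; apply/set0Pn; exists p.2.
  by rewrite inE mem_head.
have sz : size s == #|[set e in unzip2 s]| by rewrite cardsE (card_uniqP u2) size_map.
by apply/existsP; exists (Tuple sz); rewrite u1 u2 eqxx.
Qed.

Lemma uniq_map_inj (T1 T2 : eqType) (f : T1 -> T2) (s : seq T1) :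
  uniq (map f s) -> {in s &, injective f}.
Proof.
elim: s => //= x s IH /andP[fx us] y z; rewrite !inE.
case/orP=> [/eqP->|ys] /orP[/eqP->|zs] // e; last exact: IH.
  by rewrite e map_f in fx.
by rewrite -e map_f in fx.
Qed.

(** In the cyclic sequence the edges before and after a vertex are both incident with it; they are
    different because, without loops, no entry follows itself. *)
Lemma cycle_degree (C : {set E}) e v : (forall e, (G e).1 != (G e).2) ->
  is_cycle G C -> e \in C -> incident v e ->
  exists e', [/\ e' \in C, e' != e & incident v e'].
Proof.
move=> noloop /andP[_ /existsP[s /and4P[_ u2 /eqP eC cs]]].
rewrite -{1}eC inE => /mapP[p ps ep] vi.
have loopF f w : joins G f w w = false.
  apply/negP=> /orP[] /eqP h; have := noloop f; by rewrite h eqxx.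
have us : uniq s by apply: map_uniq u2.
have new q : q \in tval s -> q != p -> q.2 \in C /\ q.2 != e.
  move=> qs qp; split; first by rewrite -eC inE map_f.
  by apply: contraNneq qp => h; apply/eqP/(uniq_map_inj u2); rewrite // h ep.
have jn := next_cycle cs ps; have jp := prev_cycle cs ps.
rewrite ep in vi; case: (incident_joins jn vi) => ->.
  have ns : prev s p \in tval s by rewrite mem_prev.
  have np : prev s p != p by apply/eqP=> h; rewrite h /= loopF in jp.
  have [qC qe] := new _ ns np; exists (prev s p).2; split=> //.
  by case: (joins_incident jp).
have ns : next s p \in tval s by rewrite mem_next.
have np : next s p != p by apply/eqP=> h; rewrite h /= loopF in jn.
have [qC qe] := new _ ns np; exists (next s p).2; split=> //.
by case: (joins_incident (next_cycle cs ns)).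
Qed.

Lemma acyclic_extend (A : {set E}) : acyclic G A ->
  exists2 B, B \in cycle_matroid_bases G & A \subset B.
Proof. by move=> /maxset_exists[B maxB sAB]; exists B; rewrite // inE. Qed.

Lemma acyclicPn (A C : {set E}) : is_cycle G C -> C \subset A -> acyclic G A = false.
Proof. by move=> cC sCA; apply/forallP=> /(_ C); rewrite cC sCA. Qed.

End Cycles.

Lemma cycle_mkseq (T : Type) (e : rel T) (f : nat -> T) n :
  (forall k, k < n -> e (f k) (f (k.+1 %% n))) -> cycle e (mkseq f n).
Proof.
case: n => // q ef; rewrite /mkseq /=; apply/(pathP (f 0)) => i.
rewrite size_rcons size_map size_iota => iq.
have nthE j : j <= q -> nth (f 0) (f 0 :: rcons [seq f k | k <- iota 1 q] (f 0)) j = f j.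
  case: j => //= j jq; rewrite nth_rcons size_map size_iota jq.
  by rewrite (nth_map 0) ?size_iota // nth_iota.
rewrite nthE //; have [iq'|] := ltnP i q.
  by rewrite -[nth _ _ i]/(nth (f 0) (f 0 :: _) i.+1) nthE // -(modn_small (_ : i.+1 <
    q.+1)) ?ef.
move=> qi; have -> : i = q by lia.
by rewrite nth_rcons size_map size_iota ltnn eqxx; have := ef q; rewrite modnn; apply.
Qed.

Section WheelGraphs.
Variables (r : nat) (r2 : 2 <= r).

Lemma r_gt0 : 0 < r. Proof. exact: ltnW. Qed.

Definition idx (k : nat) : 'I_r := Ordinal (ltn_pmod k r_gt0).

Lemma idx_ord (i : 'I_r) : idx i = i.
Proof. by apply: val_inj; rewrite /= modn_small. Qed.

Lemma inord_rim (i j : nat) : i < r -> j < r -> (inord i == inord j :> 'I_r.+1) = (i == j).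
Proof. by move=> ir jr; rewrite -val_eqE /= !inordK // ltnS ltnW. Qed.

Lemma inord_max (i : nat) : i < r -> (ord_max == inord i :> 'I_r.+1) = false.
Proof. by move=> ir; rewrite -val_eqE /= inordK ?ltnS 1?ltnW // gtn_eqF. Qed.

Lemma ltn_modr k : k %% r < r. Proof. by rewrite ltn_pmod // r_gt0. Qed.

Lemma succ_neq k : k < r -> (k == k.+1 %% r) = false.
Proof.
move=> kr; have [h|h] := ltnP k.+1 r; first by rewrite modn_small // ltn_eqF.
have -> : k.+1 = r by lia.
by rewrite modnn; lia.
Qed.

Lemma wheel_noloop e : (wheel r e).1 != (wheel r e).2.
Proof. by case: e => i /=; rewrite ?inord_rim ?succ_neq ?inord_max ?ltn_modr. Qed.

Lemma Ngraph_noloop e : (Ngraph r e).1 != (Ngraph r e).2.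
Proof.
case: e => i /=; rewrite ?inord_rim ?succ_neq ?ltn_modr //.
by rewrite -val_eqE /= ltn_eqF // r_gt0.
Qed.

(** Stated for any graph with these rim edges, as it serves both [wheel] and [Ngraph]. *)
Lemma rim_is_cycle (G : multigraph 'I_r.+1 ('I_r + 'I_r)%type) :
  (forall i : 'I_r, G (inl i) = (inord i, inord (i.+1 %% r))) -> is_cycle G (rim r).
Proof.
move=> GE; pose f k : 'I_r.+1 * ('I_r + 'I_r) := (inord k, inl (idx k)).
have -> : rim r = [set e in unzip2 (mkseq f r)].
  apply/setP=> e; rewrite inE; apply/imsetP/mapP=> [[i _ ->]|[p /mapP[k _ ->] ->]].
    exists (f i); last by rewrite /= idx_ord.
    by apply: map_f; rewrite mem_iota ltn_ord.
  by exists (idx k).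
apply: is_cycle_seq.
- by rewrite -size_eq0 size_mkseq -lt0n r_gt0.
- rewrite /unzip1 /unzip2 /mkseq -map_comp map_inj_in_uniq ?iota_uniq // => i j;
  rewrite !mem_iota /= => ir jr.
  by move/eqP; rewrite inord_rim // => /eqP.
- rewrite /unzip1 /unzip2 /mkseq -map_comp map_inj_in_uniq ?iota_uniq // => i j;
  rewrite !mem_iota /= => ir jr.
  by case; rewrite !modn_small.
apply: cycle_mkseq => k kr.
by rewrite /joins GE /= (modn_small kr) eqxx.
Qed.

Lemma triangle_is_cycle k :
  is_cycle (wheel r) [set inr (idx k); inl (idx k); inr (idx k.+1)].
Proof.
have k1 : (k %% r).+1 %% r = k.+1 %% r by rewrite -addn1 modnDml addn1.
have kk : k %% r == k.+1 %% r = false by rewrite -k1 succ_neq // ltn_modr.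
pose s : seq ('I_r.+1 * ('I_r + 'I_r)) := [:: (ord_max, inr (idx k));
  (inord (k %% r), inl (idx k)); (inord (k.+1 %% r), inr (idx k.+1))].
rewrite (_ : [set _; _; _] = [set e in unzip2 s]); last first.
  by apply/setP=> e; rewrite !inE orbA.
apply: is_cycle_seq => //; rewrite /= ?inE ?negb_or ?inord_max ?inord_rim ?ltn_modr ?kk //.
  by rewrite andbT andbC andbT; apply/eqP=> -[] h; move: kk; rewrite h eqxx.
by rewrite /joins /= k1 !eqxx !orbT.
Qed.

Lemma parallel_is_cycle (i j : 'I_r) : i != j -> is_cycle (Ngraph r) [set inr i; inr j].
Proof.
move=> ij; pose s : seq ('I_r.+1 * ('I_r + 'I_r)) := [:: (ord0, inr i); (ord_max, inr j)].
rewrite (_ : [set _; _] = [set e in unzip2 s]); last first.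
  by apply/setP=> e; rewrite !inE.
apply: is_cycle_seq => //; rewrite /= ?inE ?andbT; last by rewrite /joins /= !eqxx ?orbT.
  by rewrite -val_eqE /= ltn_eqF // r_gt0.
by apply: contraNneq ij => -[->].
Qed.

Lemma succE k : k < r -> k.+1 %% r = if k.+1 == r then 0 else k.+1.
Proof.
move=> kr; case: eqP => [->|/eqP h]; first by rewrite modnn.
by rewrite modn_small // ltn_neqAle h.
Qed.

Lemma card_rim : #|rim r| = r.
Proof. by rewrite card_imset ?card_ord // => i j []. Qed.

Lemma inr_rim j : (inr j \in rim r) = false.
Proof. by apply/imsetP=> -[]. Qed.

Lemma inl_rim i : inl i \in rim r.
Proof. exact: imset_f. Qed.

Lemma wheel_parallel (e e' : 'I_r + 'I_r) : e' != e ->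
  incident (wheel r) (wheel r e).1 e' -> incident (wheel r) (wheel r e).2 e' ->
  r = 2 /\ [set e; e'] = rim r.
Proof.
rewrite /incident; case: e e' => [] i [] j /= ne.
- rewrite !inord_rim ?ltn_modr // !succE // => h1 h2.
  have ij : (i : nat) != j by apply: contraNneq ne => /val_inj ->.
  have rr : r = 2.
    have := ltn_ord i; have := ltn_ord j; move: h1 h2.
    by case: (i.+1 =P r); case: (j.+1 =P r); lia.
  split=> //; apply/eqP; rewrite eqEcard card_rim cards2 eq_sym ne.
  by apply/andP; split; [rewrite subUset !sub1set !inl_rim | rewrite /=; lia].
- by rewrite ![inord _ == ord_max]eq_sym !inord_max ?ltn_modr //= !inord_rim ?ltn_modr // =>
    /eqP {1}<- /eqP; move/eqP; rewrite eq_sym succ_neq.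
- by rewrite !inord_max ?ltn_modr.
- rewrite [inord _ == ord_max]eq_sym inord_max //= inord_rim // => _ /eqP/val_inj ij.
  by rewrite ij eqxx in ne.
Qed.

(** By [cycle_degree] an edge of a cycle meets another edge of it at each end. Within two elements
    this is the same edge twice, so the two are parallel, which [wheel_parallel] allows only for the
    rim with [r = 2]. *)
Lemma wheel_small_acyclic (A : {set 'I_r + 'I_r}) : #|A| <= 2 ->
  acyclic (wheel r) A \/ A = rim r.
Proof.
move=> leA; have [|/forallPn[C]] := boolP (acyclic (wheel r) A); first by left.
rewrite negb_imply negbK => /andP[cC sCA]; right.
have /andP[/set0Pn[e eC] _] := cC.
have inc v : v \in [:: (wheel r e).1; (wheel r e).2] -> incident (wheel r) v e.
  by rewrite !inE.
have [e1 [e1C ne1 i1]] := cycle_degree wheel_noloop cC eC (inc _ (mem_head _ _)).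
have [|e2 [e2C ne2 i2]] := cycle_degree wheel_noloop cC eC (inc (wheel r e).2 _).
  by rewrite !inE eqxx orbT.
have eA : [set e; e1] = A.
  apply/eqP; rewrite eqEcard cards2 eq_sym ne1 leA andbT.
  by rewrite subUset !sub1set !(subsetP sCA).
have e12 : e2 = e1.
  have : e2 \in A by rewrite (subsetP sCA).
  by rewrite -eA !inE (negPf ne2) => /eqP.
by rewrite e12 in i2; have [_ <-] := wheel_parallel ne1 i1 i2.
Qed.

Lemma Ngraph_rim_step (C : {set 'I_r + 'I_r}) k : is_cycle (Ngraph r) C -> C \subset rim r ->
  inl (idx k) \in C -> inl (idx k.+1) \in C.
Proof.
move=> cC sC kC.
have k1 : (k %% r).+1 %% r = k.+1 %% r by rewrite -addn1 modnDml addn1.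
have inc : incident (Ngraph r) (inord (k.+1 %% r)) (inl (idx k)).
  by rewrite /incident /= k1 eqxx orbT.
have [e [eC ne]] := cycle_degree Ngraph_noloop cC kC inc.
have /imsetP[l _ el] := subsetP sC e eC; subst e.
rewrite /incident /= !inord_rim ?ltn_modr // => /orP[] /eqP kl.
  by rewrite (_ : idx k.+1 = l) //; apply: val_inj.
case/eqP: ne; congr inl; apply: val_inj => /=; move: kl; rewrite -k1.
rewrite !succE ?ltn_modr //; case: eqP; case: eqP; lia.
Qed.

(** A cycle through [ord_max] would use two edges off the rim, and a cycle inside the rim passes
    from each edge to the next and so contains [inl i]. *)
Lemma Ngraph_acyclic (B : {set 'I_r + 'I_r}) i : inl i \notin B -> #|B :\: rim r| <= 1 ->
  acyclic (Ngraph r) B.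
Proof.
move=> iB /card_le1_eqP B1; apply/forallP=> C; apply/implyP=> cC; apply/negP=> sCB.
have sC : C \subset rim r.
  apply/subsetP=> -[j|j] jC; first exact: inl_rim.
  have inc : incident (Ngraph r) ord_max (inr j) by rewrite /incident /= eqxx orbT.
  have [[l|l] [lC ne]] := cycle_degree Ngraph_noloop cC jC inc.
    by rewrite /incident /= !inord_max ?ltn_modr.
  move=> _; case/eqP: ne; apply: B1; by rewrite inE inr_rim (subsetP sCB).
have /andP[/set0Pn[e eC] _] := cC; have /imsetP[l _ el] := subsetP sC e eC; subst e.
have h m : inl (idx (l + m)) \in C.
  by elim: m => [|m IH]; rewrite ?addn0 ?idx_ord // addnS Ngraph_rim_step.
have := h (r - l + i); rewrite (_ : idx _ = i) => [/(subsetP sCB)|]; first exact/negP.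
apply: val_inj; rewrite /= addnA subnKC; last exact/ltnW/ltn_ord.
by rewrite modnDl modn_small.
Qed.

Lemma Ngraph_acyclicP (B : {set 'I_r + 'I_r}) : acyclic (Ngraph r) B ->
  #|B :\: rim r| <= 1 /\ exists i, inl i \notin B.
Proof.
move=> /forallP acB; split.
  apply/card_le1_eqP=> -[i|i] [j|j]; rewrite !inE ?inl_rim ?inr_rim //= => iB jB.
  apply/eqP/negPn/negP=> ne; have := acB [set inr i; inr j].
  rewrite parallel_is_cycle; last by apply: contraNneq ne => ->.
  by rewrite subUset !sub1set iB jB.
have := acB (rim r); rewrite rim_is_cycle // => /subsetPn[e /imsetP[i _ ->]].
by exists i.
Qed.

Lemma Ngraph_bases (B : {set 'I_r + 'I_r}) :
  (B \in MN r) = (#|B| == r) && (#|B :\: rim r| == 1).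
Proof.
have cI (i : 'I_r) (A : {set 'I_r + 'I_r}) : inl i \notin A -> #|A :&: rim r| <= r.-1.
  move=> iA; rewrite -ltnS prednK ?r_gt0 //.
  apply: leq_trans (_ : _ < #|rim r|) _; last by rewrite card_rim.
  apply/proper_card/properP; split; first exact: subsetIr.
  by exists (inl i); rewrite ?inl_rim // inE (negPf iA).
rewrite inE; apply/maxsetP/andP=> [[acB maxB]|[/eqP cB /eqP cB1]]; last first.
  have [i iB] : exists i, inl i \notin B.
    have /subsetPn[e /imsetP[i _ ->]] : ~~ (rim r \subset B); last by exists i.
    apply/negP=> sRB; have eB : rim r = B by apply/eqP; rewrite eqEcard sRB cB card_rim /=.
    by rewrite eB setDv cards0 in cB1.
  split=> [|A acA sBA]; first by apply: Ngraph_acyclic iB _; rewrite cB1.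
  have [A1 [j jA]] := Ngraph_acyclicP acA.
  apply/esym/eqP; rewrite eqEcard sBA cB -(cardsID (rim r) A).
  have := cI j A jA; have := r_gt0; lia.
have [B1 [i iB]] := Ngraph_acyclicP acB.
have [j sj] : exists j, B :\: rim r \subset [set inr j].
  have [->|[[j|j] jB]] := set_0Vmem (B :\: rim r).
  - by exists (idx 0); apply: sub0set.
  - by rewrite inE inl_rim in jB.
  exists j; apply/subsetP=> e eB; rewrite inE; apply/eqP.
  by move/card_le1_eqP: B1; apply.
(* [inr j] is the edge of [B] off the rim, or an arbitrary one if there is none; [A] is acyclic and
   contains [B], so maximality gives equality. *)
pose A := inr j |: (rim r :\ inl i).
have cA1 : A :\: rim r = [set inr j].
  apply/setP=> e; rewrite !inE; have [->|_] := eqVneq e (inr j); first by rewrite inr_rim.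
  by case: (e \in rim r); rewrite ?andbF.
have eA : A = B.
  apply: maxB.
    apply: (@Ngraph_acyclic _ i); last by rewrite cA1 cards1.
    by rewrite !inE eqxx.
  apply/subsetP=> e eB; rewrite !inE; have [eR|eR] := boolP (e \in rim r).
    by rewrite andbT; apply/orP; right; apply: contraNneq iB => <-.
  by have := subsetP sj e; rewrite !inE eR eB => ->.
rewrite -eA cA1 cards1; split=> //; rewrite /A cardsU1 !inE inr_rim andbF /=.
by have := cardsD1 (inl i) (rim r); rewrite inl_rim card_rim => eR; apply/eqP/esym.
Qed.

End WheelGraphs.

(** * Matroids whose triangles follow a cyclic order *)

Section CyclicOrder.
Variables (E : finType) (r : nat) (u : nat -> E).
Hypothesis r2 : 2 <= r.
Hypothesis u_eq : forall j k, (u j == u k) = (j == k %[mod r.*2]).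
Hypothesis u_surj : forall x, exists k, x = u k.
Implicit Types (X P : matroid E) (A B W : {set E}).

(* [u] runs through the elements in cyclic order with period [2r]; spokes are at
   even and rim elements at odd positions. *)
Definition spoke i := u i.*2.
Definition rimel i := u i.*2.+1.
Definition rims : {set E} := [set rimel i | i : 'I_r].
Definition uarc a m : {set E} := [set u (a + k) | k : 'I_m].

Lemma u_periodic k : u (k + r.*2) = u k.
Proof. by apply/eqP; rewrite u_eq modnDr. Qed.

Lemma u_window a k : exists2 l, l < r.*2 & u k = u (a + l).
Proof.
have r0 : 0 < r.*2 by lia.
exists ((k + (r.*2 - a %% r.*2)) %% r.*2); first by rewrite ltn_pmod.
apply/eqP; rewrite u_eq modnDmr -modnDml.
have lt := ltn_pmod a r0.
by rewrite addnCA subnKC ?modnDr // ltnW.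
Qed.

Lemma u_inj_window a k l : k < r.*2 -> l < r.*2 -> (u (a + k) == u (a + l)) = (k == l).
Proof. by move=> kr lr; rewrite u_eq eqn_modDl !modn_small. Qed.

Lemma u_rims k : (u k \in rims) = odd k.
Proof.
have r0 : 0 < r.*2 by lia.
have oddm j : odd (j %% r.*2) = odd j by rewrite {2}(divn_eq j r.*2) oddD oddM odd_double andbF.
apply/imsetP/idP=> [[i _ /eqP]|ok].
  by rewrite u_eq => /eqP h; rewrite -oddm h oddm /= odd_double.
have lt : (k %% r.*2)./2 < r by have := ltn_pmod k r0; lia.
exists (Ordinal lt) => //; apply/eqP; rewrite u_eq /=.
have := odd_double_half (k %% r.*2); rewrite oddm ok add1n => ->.
by rewrite modn_mod.
Qed.

Lemma spoke_rims i : (spoke i \in rims) = false.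
Proof. by rewrite u_rims odd_double. Qed.

Lemma rimel_rims i : rimel i \in rims.
Proof. by rewrite u_rims /= odd_double. Qed.

Lemma eltP x : (exists i, x = spoke i) \/ (exists i, x = rimel i).
Proof.
have [k ->] := u_surj x; rewrite -(odd_double_half k).
by case: (odd k); [right | left]; exists k./2.
Qed.

Lemma spoke_periodic i : spoke (i + r) = spoke i.
Proof. by rewrite /spoke doubleD u_periodic. Qed.

Lemma rimel_periodic i : rimel (i + r) = rimel i.
Proof. by rewrite /rimel doubleD -addSn u_periodic. Qed.

Lemma spoke_eq i j : (spoke i == spoke j) = (i == j %[mod r]).
Proof. by rewrite u_eq -!muln2 -!muln_modl eqn_pmul2r. Qed.

Lemma rimel_eq i j : (rimel i == rimel j) = (i == j %[mod r]).
Proof.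
rewrite u_eq -[i.*2.+1]addn1 -[j.*2.+1]addn1 eqn_modDr -!muln2 -!muln_modl.
by rewrite eqn_pmul2r.
Qed.

Lemma index_window a i : exists l, [/\ l < r, spoke i = spoke (a + l) & rimel i = rimel (a
  + l)].
Proof.
have r0 : 0 < r by lia.
exists ((i + (r - a %% r)) %% r); split; first by rewrite ltn_pmod.
all: apply/eqP; rewrite ?spoke_eq ?rimel_eq modnDmr -modnDml; have lt := ltn_pmod a r0.
all: by rewrite addnCA subnKC ?modnDr // ltnW.
Qed.

Lemma card_rims : #|rims| = r.
Proof.
rewrite card_imset ?card_ord // => i j /eqP; rewrite rimel_eq !modn_small //.
by move/eqP/val_inj.
Qed.

Lemma uarcP x a m : reflect (exists2 k, k < m & x = u (a + k)) (x \in uarc a m).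
Proof.
apply: (iffP imsetP) => [[k _ ->]|[k km ->]]; first by exists k.
by exists (Ordinal km).
Qed.

Lemma uarc0 a : uarc a 0 = set0.
Proof. by apply/setP=> x; rewrite inE; apply/uarcP => -[]. Qed.

Lemma uarcS a m : uarc a m.+1 = u (a + m) |: uarc a m.
Proof.
apply/setP=> x; rewrite !inE; apply/uarcP/orP=> [[k]|[/eqP ->|/uarcP[k km ->]]].
- rewrite ltnS leq_eqVlt => /orP[/eqP -> ->|km ->]; first by left.
  by right; apply/uarcP; exists k.
- by exists m.
by exists k; rewrite // ltnS ltnW.
Qed.

Lemma mem_uarc a m k : m <= r.*2 -> k < r.*2 -> (u (a + k) \in uarc a m) = (k < m).
Proof.
move=> mr kr; apply/uarcP/idP=> [[l lm /eqP]|km]; last by exists k.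
by rewrite u_inj_window ?(leq_trans lm) // => /eqP ->.
Qed.

Lemma uarcT a : uarc a r.*2 = setT.
Proof.
apply/setP=> x; rewrite inE; apply/uarcP; have [k ->] := u_surj x.
by have [l lr e] := u_window a k; exists l.
Qed.

Lemma card_ground : #|E| = r.*2.
Proof.
rewrite -cardsT -(uarcT 0) card_imset ?card_ord // => i j /eqP.
by rewrite u_inj_window // => /eqP/val_inj.
Qed.

(** For [0 < m] the union of [m] consecutive triangles, beginning and ending with a spoke; [m = 0]
    gives a single spoke. *)
Definition fan a m := uarc a.*2 m.*2.+1.

Lemma fanS a m : fan a m.+1 = spoke (a + m).+1 |: (rimel (a + m) |: fan a m).
Proof. by rewrite /fan doubleS !uarcS /spoke /rimel !doubleS doubleD !addnS. Qed.

Lemma fan0 a : fan a 0 = [set spoke a].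
Proof. by rewrite /fan uarcS uarc0 setU0 addn0. Qed.

Lemma fan_compl1 i : fan i.+1 r.-1 = ~: [set rimel i].
Proof.
have e : rimel i = u (i.+1.*2 + r.*2.-1).
  rewrite /rimel -[LHS]u_periodic; congr u; lia.
apply/setP=> x; have [k ->] := u_surj x; have [l lr ->] := u_window i.+1.*2 k.
rewrite mem_uarc //; last by lia.
rewrite !inE e u_inj_window //; lia.
Qed.

Lemma spoke_fan a m k : k <= m -> spoke (a + k) \in fan a m.
Proof.
move=> km; apply/uarcP; exists k.*2; first by rewrite ltnS leq_double.
by rewrite /spoke doubleD.
Qed.

Lemma rimel_fan a m k : k < m -> rimel (a + k) \in fan a m.
Proof.
move=> km; apply/uarcP; exists k.*2.+1; first by rewrite ltnS; lia.
by rewrite /rimel doubleD addnS.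
Qed.

Lemma card_fan_rims a m : m < r -> #|fan a m :&: rims| = m.
Proof.
elim: m => [|m IH] mr.
  by apply/eqP; rewrite cards_eq0 fan0 -subset0; apply/subsetP=> x;
    rewrite !inE => /andP[/eqP ->]; rewrite spoke_rims.
rewrite fanS setIUl (_ : [set spoke _] :&: _ = set0) ?set0U; last first.
  by apply/setP=> x; rewrite !inE; case: eqP => // ->; rewrite spoke_rims.
rewrite setIUl (setIidPl _) ?sub1set ?rimel_rims // cardsU1 IH ?inE; last by lia.
rewrite (_ : rimel (a + m) \in fan a m = false) //.
rewrite /rimel doubleD -addnS mem_uarc; lia.
Qed.

(* The rank of an interval of the whirl. *)
Definition arc_rank A := if A \subset rims then #|A| else minn r #|A :&: rims|.+1.

Lemma arc_rank_fan a m : m < r -> arc_rank (fan a m) = m.+1.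
Proof.
move=> mr; rewrite /arc_rank card_fan_rims // (minn_idPr mr).
by case: ifP => // /subsetP/(_ _ (@spoke_fan a m 0 isT)); rewrite spoke_rims.
Qed.

Definition triangle i : {set E} := [set spoke i; rimel i; spoke i.+1].

Lemma fan1 i : fan i 1 = triangle i.
Proof.
rewrite fanS fan0 !addn0; apply/setP=> x; rewrite !inE.
by case: (x == spoke i); case: (x == rimel i); case: (x == spoke i.+1).
Qed.

Lemma half_fanl i : uarc i.*2 2 = [set spoke i; rimel i].
Proof. by rewrite !uarcS uarc0 setU0 addn0 addn1 setUC. Qed.

Lemma half_fanr i : uarc i.*2.+1 2 = [set rimel i; spoke i.+1].
Proof. by rewrite !uarcS uarc0 setU0 addn0 addn1 setUC. Qed.

Lemma spokeS_neq i : spoke i != spoke i.+1.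
Proof.
by rewrite spoke_eq; have := eqn_modDl i 0 1 r; rewrite addn0 addn1 => ->;
  rewrite !modn_small // ltnW.
Qed.

Lemma spoke_rimel_neq i j : spoke i != rimel j.
Proof. by apply/eqP=> h; have := spoke_rims i; rewrite h rimel_rims. Qed.

Lemma arc_rank_half a : arc_rank (uarc a 2) = 2.
Proof.
rewrite !uarcS uarc0 setU0 addn0 addn1 /arc_rank.
have e1 : (u a.+1 \in rims) = ~~ (u a \in rims) by rewrite !u_rims.
case: ifP => [/subsetP s|_].
  by have := s (u a) (set22 _ _); have := s (u a.+1) (set21 _ _); rewrite e1 => /negP.
rewrite (_ : #|_ :&: _| = 1); first exact/minn_idPr.
apply/eqP/cards1P; exists (if u a \in rims then u a else u a.+1); apply/setP=> x; rewrite !inE.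
case: ifP => ua; have [->|xa] := eqVneq x (u a); rewrite ?e1 ?ua ?eqxx ?andbF ?orbT //=.
- by rewrite orbF; have [->|//] := eqVneq x (u a.+1); rewrite e1 ua.
- by apply/esym/negbTE/eqP => e; move: e1; rewrite -e ua.
by rewrite orbF; have [->|//] := eqVneq x (u a.+1); rewrite e1 ua.
Qed.

(** * Consequences of the triangle rules *)

Section Triangles.
Variable X : matroid E.
Hypothesis X_card : forall B, B \in bases X -> #|B| = r.

(** The third rule of a triangle, from the two spokes to the rim element, is left out on purpose: it
    fails when the spokes are parallel. *)
Definition fan_closed W := forall i,
  (spoke i \in W -> rimel i \in W -> spoke i.+1 \in W) /\
  (rimel i \in W -> spoke i.+1 \in W -> spoke i \in W).

(** The triangles other than the one at [rimel i] form a path through all spokes, along which the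
    two rules carry membership in both directions. *)
Lemma fan_closed_spokes W i j : fan_closed W -> spoke j \in W ->
  (forall k, rimel k != rimel i -> rimel k \in W) -> forall k, spoke k \in W.
Proof.
move=> clW jW tW.
have tk k : k.+1 < r -> rimel (i.+1 + k) \in W.
  move=> kr; apply: tW; rewrite -[in rimel i](addn0 i) addSnnS rimel_eq eqn_modDl.
  by rewrite !modn_small //; lia.
have step k : k < r -> (spoke (i.+1 + k) \in W) = (spoke i.+1 \in W).
  elim: k => [|k IH] kr; first by rewrite addn0.
  have [h1 h2] := clW (i.+1 + k); rewrite -IH ?addnS; last by lia.
  by apply/idP/idP => h; [apply: h2 | apply: h1]; rewrite ?tk.
move=> k; have [l [lr -> _]] := index_window i.+1 k; rewrite step //.
by have [l' [lr' e _]] := index_window i.+1 j; rewrite -(step l') // -e.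
Qed.

Lemma bases_of_span i A : rank X (~: [set rimel i]) = r -> #|A| = r ->
  ~: [set rimel i] \subset mspan X A -> A \in bases X.
Proof.
move=> rk cA sub; have [B BX] := bases_nonempty X; have cB := X_card BX.
apply: (basis_of_rank BX); rewrite cB // -rk; exact: rank_sub_span.
Qed.

Definition one_spoke B := (#|B| == r) && (#|B :\: rims| == 1).

(** Such a [B] misses a single rim element [rimel i]. Its span contains all spokes by
    [fan_closed_spokes], hence the complement of [rimel i], which has full rank. *)
Lemma one_spoke_basis B : (forall i, rank X (~: [set rimel i]) = r) ->
  (forall A, fan_closed (mspan X A)) -> one_spoke B -> B \in bases X.
Proof.
move=> rk cl /andP[/eqP cB /cards1P[x eBx]].
have /andP[xR xB] : (x \notin rims) && (x \in B) by rewrite -in_setD eBx inE.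
have [j xj] : exists j, x = spoke j.
  by case: (eltP x) => // -[i xi]; rewrite xi rimel_rims in xR.
subst x.
have cBR : #|rims :\: B| = 1.
  have := cardsID rims B; have := cardsID B rims; rewrite setIC eBx cards1 card_rims cB; lia.
have /cards1P[x eRx] : #|rims :\: B| == 1 by rewrite cBR.
have /andP[tB /imsetP[i _ xi]] : (x \notin B) && (x \in rims) by rewrite -in_setD eRx inE.
subst x.
have inB k : rimel k != rimel i -> rimel k \in B.
  by apply: contraNT => kB; rewrite -in_set1 -eRx inE kB rimel_rims.
apply: (bases_of_span (rk i) cB); apply/subsetP=> y; rewrite in_setC1 => yi;
  case: (eltP y) => -[k yk]; subst y; last first.
  by apply/mem_mspan/inB.
apply: (@fan_closed_spokes _ i j (cl B) (mem_mspan X xB)) => l li.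
exact/mem_mspan/inB.
Qed.

Lemma rank_setT : rank X setT = r.
Proof.
have [B BX] := bases_nonempty X; have cB := X_card BX.
apply/eqP; rewrite eqn_leq -{2}cB -(rank_basis BX) rank_mono ?subsetT // andbT.
by have := rank_le_basis setT BX; rewrite cB.
Qed.

Lemma one_spokeI i j : one_spoke (spoke j |: (rims :\ rimel i)).
Proof.
rewrite /one_spoke cardsU1 !inE spoke_rims andbF /=.
have := cardsD1 (rimel i) rims; rewrite rimel_rims card_rims => e; rewrite -e eqxx /=.
apply/cards1P; exists (spoke j); apply/setP=> x; rewrite !inE.
by have [->|_] := eqVneq x (spoke j); [rewrite spoke_rims | case: (x \in rims); rewrite ?andbF].
Qed.

Lemma one_spoke_rank A : (forall B, one_spoke B -> B \in bases X) ->
  ~~ (A \subset rims) -> minn r #|A :&: rims|.+1 <= rank X A.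
Proof.
move=> oneX /subsetPn[x xA xR].
have [j xj] : exists j, x = spoke j.
  by case: (eltP x) => // -[i xi]; rewrite xi rimel_rims in xR.
subst x.
(* A one-spoke basis omits one rim element: take it outside [A] if possible, and otherwise
   arbitrary, the loss being absorbed by the bound [r]. *)
have [i iA] : exists i, minn r #|A :&: rims|.+1 <= #|(A :&: rims) :\ rimel i|.+1.
  have [sRA|/subsetPn[x /imsetP[i _ ->] iA]] := boolP (rims \subset A).
    exists 0; have := cardsD1 (rimel 0) rims; rewrite (setIidPr sRA) card_rims rimel_rims; lia.
  by exists i; have := cardsD1 (rimel i) (A :&: rims); rewrite inE (negPf iA) /=; lia.
apply: leq_trans (card_le_rank A (oneX _ (one_spokeI i j))); apply: leq_trans iA _.
apply: leq_trans (_ : #|spoke j |: ((A :&: rims) :\ rimel i)| <= _).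
  by rewrite cardsU1 !inE spoke_rims !andbF.
apply: subset_leq_card; rewrite subUset sub1set !inE xA eqxx /=.
by apply/subsetP=> y; rewrite !inE => /and3P[-> -> ->]; rewrite orbT.
Qed.

Lemma arc_rankE : (forall B, one_spoke B -> B \in bases X) ->
  (forall a m, m <= r.*2 -> rank X (uarc a m) <= #|uarc a m :&: rims|.+1) ->
  forall a m, m <= r.*2 -> rank X (uarc a m) = arc_rank (uarc a m).
Proof.
move=> oneX upper a m mr; rewrite /arc_rank; case: ifP => [|/negbT sA]; last first.
  apply/eqP; rewrite eqn_leq one_spoke_rank // andbT leq_min upper // andbT.
  by rewrite -rank_setT rank_mono ?subsetT.
(* Spokes and rim elements alternate, so an interval inside the rim has at most one element. *)
case: m mr => [|[|m]] mr; first by rewrite uarc0 cards0; have := rank_le_card X set0;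
  rewrite cards0; case: rank.
  rewrite uarcS uarc0 setU0 addn0 sub1set => uR.
  have /imsetP[i _ ->] := uR.
  apply: (rank_indep (oneX _ (one_spokeI i.+1 0))).
  rewrite sub1set !inE rimel_rims andbT; apply/orP; right; rewrite rimel_eq.
  by have := eqn_modDl i 0 1 r; rewrite addn0 addn1 => ->; rewrite !modn_small // ltnW.
rewrite !uarcS !subUset !sub1set !u_rims !addnS /= => /and3P[]; rewrite -/(odd _).
by move=> /negP.
Qed.

Definition triangular := forall i,
  [/\ spoke i.+1 \in mspan X [set spoke i; rimel i],
      spoke i \in mspan X [set rimel i; spoke i.+1]
    & rimel i \in mspan X [set spoke i; spoke i.+1]].

Lemma span_fan_closed A :
  (forall i, spoke i.+1 \in mspan X [set spoke i; rimel i]) ->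
  (forall i, spoke i \in mspan X [set rimel i; spoke i.+1]) -> fan_closed (mspan X A).
Proof.
move=> r1 r2' i; split=> iA iA'; [apply: span_closed (r1 i) _|apply: span_closed (r2' i) _];
  by rewrite subUset !sub1set iA iA'.
Qed.

(** As the interval grows, a new rim element raises the bound by one, and a new spoke lies in the
    span of the two elements before it. Where fewer than two precede, the size of the interval
    suffices. *)
Lemma arc_rank_upper : (forall i, spoke i.+1 \in mspan X [set spoke i; rimel i]) ->
  forall a m, m <= r.*2 -> rank X (uarc a m) <= #|uarc a m :&: rims|.+1.
Proof.
move=> r1 a; elim=> [|m IH] mr; first by rewrite uarc0 (leq_trans (rank_le_card _ _)) ?cards0.
have {}IH := IH (ltnW mr).
rewrite uarcS setIUl; have [uR|uR] := boolP (u (a + m) \in rims).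
  rewrite (setIidPl _) ?sub1set // cardsU1 inE mem_uarc ?(ltnW mr) // ltnn /=.
  by apply: leq_trans (rankU1 _ _ _) _; rewrite add1n ltnS.
rewrite (_ : [set _] :&: rims = set0) ?set0U; last first.
  by apply/setP=> x; rewrite !inE; case: eqP => // ->; rewrite (negPf uR).
case: m mr IH uR => [|[|m]] mr IH uR.
- by rewrite uarc0 setU0 set0I cards0; apply: leq_trans (rank_le_card _ _) _; rewrite cards1.
- apply: leq_trans (rankU1 _ _ _) _; apply: leq_trans (rank_le_card _ _) _.
  rewrite uarcS uarc0 setU0 addn0 (setIidPl _) ?cards1 // sub1set u_rims.
  by move: uR; rewrite u_rims addn1 /= negbK.
apply: leq_trans IH; apply: rank_sub_span; rewrite subUset sub_mspan andbT sub1set.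
have e : u (a + m.+2) = spoke ((a + m)./2).+1 /\ u (a + m.+1) = rimel (a + m)./2 /\
    u (a + m) = spoke (a + m)./2.
  have := odd_double_half (a + m); rewrite u_rims !addnS /= negbK in uR.
  by rewrite (negPf uR) add0n /spoke /rimel doubleS !addnS => ->.
case: e => -> [e1 e2]; apply: span_closed (r1 _) _; rewrite -e1 -e2 subUset !sub1set.
by rewrite !mem_mspan // mem_uarc //; lia.
Qed.

Lemma triangular_corank : triangular -> forall i, rank X (~: [set rimel i]) = r.
Proof.
move=> tri i; rewrite -rank_setT; apply/eqP; rewrite eqn_leq rank_mono ?subsetT //=.
apply: rank_sub_span; apply/subsetP=> x _.
have [->|xi] := eqVneq x (rimel i); last by rewrite mem_mspan // !inE.
have [_ _ r3] := tri i; apply: span_closed r3 _.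
by rewrite subUset !sub1set !mem_mspan // !inE spoke_rimel_neq.
Qed.

Lemma triangular_one_spoke B : triangular -> one_spoke B -> B \in bases X.
Proof.
move=> tri; apply: one_spoke_basis; first exact: triangular_corank.
by move=> A; apply: span_fan_closed => i; have [] := tri i.
Qed.

Lemma triangular_arc_rank : triangular ->
  forall a m, m <= r.*2 -> rank X (uarc a m) = arc_rank (uarc a m).
Proof.
move=> tri; apply: arc_rankE; first by move=> B; apply: triangular_one_spoke.
by apply: arc_rank_upper => i; have [] := tri i.
Qed.

End Triangles.


Lemma uarcSl a m : uarc a m.+1 = u a |: uarc a.+1 m.
Proof.
elim: m => [|m IH]; first by rewrite uarcS !uarc0 addn0.
by rewrite uarcS IH setUCA -[RHS]/(_ |: _) uarcS addSnnS.
Qed.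

Lemma fanSl a m : fan a m.+1 = spoke a |: (rimel a |: fan a.+1 m).
Proof. by rewrite /fan doubleS 2!uarcSl doubleS. Qed.

(* If [spoke a] is in [W] and the next spoke in [W] is [spoke (a + k + 1)], with
   [0 < k], then [W] misses the bond formed by the [k] spokes in between and the
   two rim elements [rimel a] and [rimel (a + k)]. *)
Lemma fan_closed_rank P W : (forall B, B \in bases P -> #|B| = r) ->
    (forall a m, m < r -> rank P (fan a m) <= m.+1) ->
    fan_closed W -> (forall i, spoke i \in W -> spoke i.+1 \in W -> rimel i \in W) ->
    ~~ (W \subset rims) -> W != setT -> rank P W < r.
Proof.
move=> cP fanP clW clW3 /subsetPn[x xW xR] WT.
have [j xj] : exists j, x = spoke j.
  by case: (eltP x) => // -[i xi]; rewrite xi rimel_rims in xR.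
subst x.
have [i iW] : exists i, spoke i \notin W.
  move: WT; rewrite -subTset => /subsetPn[x _ xW'].
  case: (eltP x) => -[i xi]; subst x; first by exists i.
  have [iW|iW] := boolP (spoke i \in W); last by exists i.
  by exists i.+1; apply: contra xW' => /(clW3 i iW).
have exl : exists l, spoke (j + l) \notin W.
  by have [l [_ e _]] := index_window j i; exists l; rewrite -e.
have [a aW aW'] : exists2 a, spoke a \in W & spoke a.+1 \notin W.
  case: (ex_minnP exl) => -[|l] lW lmin; first by rewrite addn0 xW in lW.
  exists (j + l); last by rewrite -addnS.
  by apply: contraT => /lmin; rewrite ltnn.
have exk : exists k, spoke (a.+1 + k) \in W.
  by exists r.-1; rewrite addSnnS prednK ?spoke_periodic // ltnW.
case: (ex_minnP exk) => k kW kmin.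
have kr : k <= r.-1 by apply: kmin; rewrite addSnnS prednK ?spoke_periodic // ltnW.
have k0 : 0 < k by case: k kW {kmin kr} => //; rewrite addn0 (negPf aW').
have out l : l < k -> spoke (a.+1 + l) \notin W by apply: contraL => /kmin; rewrite -leqNgt.
have taW : rimel a \notin W by apply: contra aW' => h; case: (clW a) => /(_ aW h).
have tkW : rimel (a + k) \notin W.
  have := out k.-1; rewrite addSnnS prednK // leqnn => /(_ isT); apply: contra => h.
  by case: (clW (a + k)) => _; apply; rewrite // -addSn.
(* The rim elements strictly inside the gap, at most [k - 1] of them; the fan outside the gap has
   rank at most [r - k], which leaves [r - 1] in total. *)
pose D : {set E} := [set rimel (a.+1 + l) | l : 'I_k.-1].
have sW : W \subset fan (a.+1 + k) (r.-1 - k) :|: D.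
  apply/subsetP=> x; rewrite in_setU; case: (eltP x) => -[i' xi]; subst x;
    have [l [lr es er]] := index_window a.+1 i'; rewrite ?es ?er => lW.
    have kl : k <= l by apply: kmin.
    by rewrite -(subnKC kl) addnA spoke_fan //; clear - kl lr; lia.
  have [kl|lk] := leqP k l.
    rewrite -(subnKC kl) addnA rimel_fan //.
    suff : l != r.-1 by clear - kl lr; lia.
    by apply: contraNneq taW => e; move: lW; rewrite e addSnnS prednK ?rimel_periodic // ltnW.
  apply/orP; right; have lk' : l < k.-1.
    suff : l != k.-1 by clear - lk; lia.
    by apply: contraNneq tkW => e; move: lW; rewrite e addSnnS prednK.
  by apply/imsetP; exists (Ordinal lk').
have := rank_mono P sW; have := rankU P (fan (a.+1 + k) (r.-1 - k)) D.
have : #|D| <= k.-1 by rewrite -[k.-1]card_ord leq_imset_card.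
have := fanP (a.+1 + k) (r.-1 - k); move: (rank P _) (rank P W) (rank P _) #|D|;
  clear - r2 k0 kr; lia.
Qed.

Definition arc_ranked X := forall a m, m <= r.*2 -> rank X (uarc a m) = arc_rank (uarc a m).

Lemma arc_ranked_fan X a m : arc_ranked X -> m < r -> rank X (fan a m) = m.+1.
Proof. by move=> aX mr; rewrite aX ?arc_rank_fan //; lia. Qed.

Lemma arc_ranked_card X B : arc_ranked X -> B \in bases X -> #|B| = r.
Proof.
move=> aX BX; have r0 : 0 < r by lia.
have h : rank X setT = r.
  rewrite -(uarcT 0) aX // uarcT /arc_rank setTI card_rims.
  rewrite (minn_idPl _) //; case: ifP => // /subsetP/(_ (spoke 0)).
  by rewrite inE spoke_rims => /(_ isT).
apply/eqP; rewrite eqn_leq -{2}h rank_le_basis // andbT -(rank_basis BX) -h.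
by rewrite rank_mono ?subsetT.
Qed.

(** * Matroids with the interval ranks of the whirl *)

Section ArcRanked.
Variable X : matroid E.
Hypothesis aX : arc_ranked X.
Let X_card B : B \in bases X -> #|B| = r := @arc_ranked_card X B aX.

Lemma arc_ranked_triangle i : rank X (triangle i) = 2.
Proof. by rewrite -fan1 arc_ranked_fan. Qed.

Lemma arc_ranked_rule1 i : spoke i.+1 \in mspan X [set spoke i; rimel i].
Proof.
apply: (@span_of_rank _ _ _ (triangle i)); first exact: subsetUl.
  by rewrite !inE eqxx !orbT.
by rewrite arc_ranked_triangle -half_fanl aX ?arc_rank_half //; lia.
Qed.

Lemma arc_ranked_rule2 i : spoke i \in mspan X [set rimel i; spoke i.+1].
Proof.
apply: (@span_of_rank _ _ _ (triangle i)); first by rewrite /triangle -setUA subsetUr.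
  by rewrite !inE eqxx.
by rewrite arc_ranked_triangle -half_fanr aX ?arc_rank_half //; lia.
Qed.

Lemma arc_ranked_corank i : rank X (~: [set rimel i]) = r.
Proof. by rewrite -fan_compl1 arc_ranked_fan //; lia. Qed.

Lemma arc_ranked_one_spoke B : one_spoke B -> B \in bases X.
Proof.
apply: one_spoke_basis => //; first exact: arc_ranked_corank.
by move=> A; apply: span_fan_closed; [exact: arc_ranked_rule1 | exact: arc_ranked_rule2].
Qed.

Definition parallel_spokes i := spoke i.+1 \in mspan X [set spoke i].

(** If s_(i+2) is not parallel to s_(i+1), these two span t_(i+1). The fan [F] from s_(i+2) round to
    s_i spans s_(i+1), which is parallel to s_i, then t_(i+1), and so the complement of t_i. That
    has rank r, whereas [F] has rank r - 1. *)
Lemma parallel_step i : parallel_spokes i -> parallel_spokes i.+1.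
Proof.
move=> pari; apply: contraT => npar.
have r1S j : rank X [set spoke j] = 1 by rewrite -fan0 arc_ranked_fan //; lia.
have rule3 : rimel i.+1 \in mspan X [set spoke i.+1; spoke i.+2].
  apply: (@span_of_rank _ _ _ (triangle i.+1)).
  - by rewrite /triangle subUset !sub1set !inE !eqxx ?orbT.
  - by rewrite !inE eqxx ?orbT.
  rewrite arc_ranked_triangle setUC -[1]/(1) -(r1S i.+1) ltn_neqAle rank_mono ?subsetUr //
    andbT.
  by move: npar; rewrite /parallel_spokes inE eq_sym.
pose F := fan i.+2 r.-2.
have iF : spoke i \in F.
  by rewrite -spoke_periodic (_ : i + r = i.+2 + r.-2) ?spoke_fan //; lia.
have i1F : spoke i.+1 \in mspan X F by apply: span_closed pari _; rewrite sub1set mem_mspan.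
have i2F : spoke i.+2 \in mspan X F.
  by rewrite mem_mspan // -[i.+2]addn0 spoke_fan.
have t1F : rimel i.+1 \in mspan X F by apply: span_closed rule3 _; rewrite subUset !sub1set i1F.
have : rank X (fan i.+1 r.-1) <= rank X F.
  apply: rank_sub_span; rewrite (_ : r.-1 = r.-2.+1); last by lia.
  by rewrite fanSl !subUset !sub1set i1F t1F sub_mspan.
rewrite /F !arc_ranked_fan //; lia.
Qed.

(** Propagation in one direction reaches every index because indices are cyclic. *)
Lemma parallel_all i j : parallel_spokes i -> parallel_spokes j.
Proof.
move=> pari; have h k : parallel_spokes (i + k).
  by elim: k => [|k IH]; rewrite ?addn0 // addnS; apply: parallel_step.
have [l [_ e _]] := index_window i j.
have := h l; rewrite /parallel_spokes -e -addnS => hl.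
suff -> : spoke j.+1 = spoke (i + l.+1) by [].
move/eqP: e; rewrite spoke_eq => e; apply/eqP; rewrite spoke_eq.
by rewrite addnS -[j.+1]addn1 -[(i + l).+1]addn1 eqn_modDr.
Qed.

Lemma nonparallel_triangular : ~~ parallel_spokes 0 -> triangular X.
Proof.
move=> npar i; split; [exact: arc_ranked_rule1 | exact: arc_ranked_rule2|].
have r1S j : rank X [set spoke j] = 1 by rewrite -fan0 arc_ranked_fan //; lia.
apply: (@span_of_rank _ _ _ (triangle i)).
- by rewrite /triangle subUset !sub1set !inE !eqxx ?orbT.
- by rewrite !inE eqxx ?orbT.
rewrite arc_ranked_triangle setUC -(r1S i) ltn_neqAle rank_mono ?subsetUr // andbT.
by apply: contra npar => h; apply: (@parallel_all i); rewrite /parallel_spokes inE eq_sym.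
Qed.

Lemma parallel_bases : parallel_spokes 0 -> forall B, B \in bases X -> #|B :\: rims| <= 1.
Proof.
move=> par0 B BX.
have sp j : spoke j \in mspan X [set spoke 0].
  elim: j => [|j IH]; first by rewrite mem_mspan // inE.
  by apply: span_closed (parallel_all j par0) _; rewrite sub1set.
rewrite setDE setIC; apply: leq_trans (card_le_rank _ BX) _.
apply: leq_trans (_ : rank X [set spoke 0] <= 1);
  last by rewrite (leq_trans (rank_le_card _ _)) ?cards1.
apply: rank_sub_span; apply/subsetP=> x; rewrite inE.
by case: (eltP x) => -[i ->] //; rewrite rimel_rims.
Qed.

(** The span is taken in [X] but measured in [P]: a proper one has rank less than [r] in [P] by
    [fan_closed_rank], although it contains the basis [B] of [P]. Used in both directions, this
    makes two triangular matroids agree off the rim. *)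
Lemma triangular_transfer P B : triangular X -> arc_ranked P -> B \in bases P -> B != rims ->
  B \in bases X.
Proof.
move=> triX aP BP BR; have [C CX] := bases_nonempty X.
have cB := arc_ranked_card aP BP; have cC := X_card CX.
have [sT|nT] := eqVneq (mspan X B) setT.
  apply: (basis_of_rank CX); first by rewrite cB cC.
  by rewrite cC -(rank_setT X_card) rank_sub_span // sT.
have : rank P (mspan X B) < r.
  apply: fan_closed_rank nT => //.
  - by move=> D; apply: arc_ranked_card.
  - by move=> a m mr; rewrite arc_ranked_fan.
  - by apply: span_fan_closed; [exact: arc_ranked_rule1 | exact: arc_ranked_rule2].
  - move=> i iB i1B; have [_ _ h] := triX i; apply: span_closed h _.
    by rewrite subUset !sub1set iB.
  apply: contra BR => sBR; rewrite eqEcard card_rims cB leqnn andbT.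
  exact: subset_trans (sub_mspan X B) sBR.
by rewrite ltnNge -cB -(rank_basis BP) rank_mono ?sub_mspan.
Qed.

End ArcRanked.

Lemma arc_ranked_bases P X : (forall B, B \in bases P -> #|B| = r) -> triangular P ->
  rims \in bases P ->
  arc_ranked X <-> bases X \in [:: [set B | one_spoke B]; rims |: [set B | one_spoke B];
     bases P :\ rims; bases P].
Proof.
move=> cP triP RP; have aP := triangular_arc_rank cP triP.
have Rone : one_spoke rims = false by rewrite /one_spoke setDv cards0 andbF.
split=> [aX|].
  have cX B := @arc_ranked_card X B aX.
  have [par|npar] := boolP (parallel_spokes X 0).
    have eX B : B != rims -> (B \in bases X) = one_spoke B.
      move=> BR; apply/idP/idP=> [BX|]; last exact: arc_ranked_one_spoke.
      rewrite /one_spoke cX // eqxx eqn_leq (parallel_bases aX par BX) /=.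
      rewrite lt0n cards_eq0 setD_eq0; apply: contra BR => sB.
      by rewrite eqEcard sB card_rims cX /=.
    have [RX|RX] := boolP (rims \in bases X).
      rewrite [bases X](_ : _ = rims |: [set B | one_spoke B]) ?inE ?eqxx ?orbT //.
      by apply/setP=> B; rewrite !inE; have [->|/eX ->] := eqVneq B rims.
    rewrite [bases X](_ : _ = [set B | one_spoke B]) ?inE ?eqxx ?orbT //.
    by apply/setP=> B; rewrite !inE; have [->|/eX ->] := eqVneq B rims;
      rewrite ?Rone ?(negPf RX).
  have triX := nonparallel_triangular aX npar.
  have eX B : B != rims -> (B \in bases X) = (B \in bases P).
    move=> BR; apply/idP/idP => BX; first exact: (triangular_transfer aP triP aX BX BR).
    exact: (triangular_transfer aX triX aP BX BR).
  have [RX|RX] := boolP (rims \in bases X).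
    rewrite [bases X](_ : _ = bases P) ?inE ?eqxx ?orbT //.
    by apply/setP=> B; have [->|/eX ->] := eqVneq B rims; rewrite ?RX.
  rewrite [bases X](_ : _ = bases P :\ rims) ?inE ?eqxx ?orbT //.
  by apply/setP=> B; rewrite !inE; have [->|/eX ->] := eqVneq B rims; rewrite ?(negPf RX).
(* For the converse, one-spoke sets are bases in all four families, so the upper bound of
   [arc_rankE] is at stake. It is a count when bases have at most one spoke, and is inherited from
   [P] for subfamilies of [bases P]. *)
have upper : (forall B, B \in bases X -> #|B :\: rims| <= 1) ->
    forall a m, m <= r.*2 -> rank X (uarc a m) <= #|uarc a m :&: rims|.+1.
  move=> B1 a m _; have [B BX <-] := rank_attained X (uarc a m).
  rewrite -(cardsID rims) -addn1 leq_add //.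
    by rewrite subset_leq_card // setIAC subsetIl.
  by apply: leq_trans (B1 B BX); rewrite subset_leq_card // setSD // subsetIr.
have upperP : bases X \subset bases P ->
    forall a m, m <= r.*2 -> rank X (uarc a m) <= #|uarc a m :&: rims|.+1.
  move=> sXP a m mr; have [B BX <-] := rank_attained X (uarc a m).
  apply: leq_trans (card_le_rank _ (subsetP sXP B BX)) _.
  by apply: arc_rank_upper mr => i; have [] := triP i.
have oneR B : one_spoke B -> B != rims by apply: contraTneq => ->; rewrite Rone.
rewrite !inE => /or4P[] /eqP eX; apply: arc_rankE.
- by move=> B; rewrite eX inE => /andP[/eqP].
- by move=> B; rewrite eX inE.
- by apply: upper => B; rewrite eX inE => /andP[_ /eqP ->].
- by move=> B; rewrite eX !inE => /orP[/eqP ->|/andP[/eqP]//]; rewrite card_rims.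
- by move=> B; rewrite eX !inE orbC => ->.
- by apply: upper => B; rewrite eX !inE => /orP[/eqP ->|/andP[_ /eqP ->]//];
  rewrite setDv cards0.
- by move=> B; rewrite eX inE => /andP[_ /cP].
- by move=> B oB; rewrite eX !inE oneR // triangular_one_spoke.
- by apply: upperP; rewrite eX subsetDl.
- by move=> B; rewrite eX => /cP.
- by move=> B oB; rewrite eX triangular_one_spoke.
by apply: upperP; rewrite eX.
Qed.

End CyclicOrder.

(** * The labels of a whirl *)

Lemma imset_preimset_can (T1 T2 : finType) (f : T1 -> T2) g (A : {set T2}) :
  cancel g f -> f @: (f @^-1: A) = A.
Proof.
move=> gK; apply/setP=> x; apply/imsetP/idP=> [[y + ->]|xA]; first by rewrite inE.
by exists (g x); rewrite ?inE gK.
Qed.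

Section WhirlLabels.
Variables (r : nat) (r2 : 2 <= r) (E : finType) (P : matroid E).
Variables (f : E -> 'I_r + 'I_r) (g : 'I_r + 'I_r -> E).
Hypotheses (fK : cancel f g) (gK : cancel g f).
Hypothesis whirlP : forall B : {set E}, (f @: B \in whirl r) = (B \in bases P).

Definition label k : 'I_r + 'I_r := if odd k then inl (idx r2 k./2) else inr (idx r2 k./2).

Definition enum_labels k := g (label k).

Lemma label_eq j k : (label j == label k) = (j == k %[mod r.*2]).
Proof.
have -> : (label j == label k) = (odd j == odd k) && (j./2 == k./2 %[mod r]).
  by rewrite /label; case: (odd j); case: (odd k).
have oddm i : odd (i %% r.*2) = odd i by rewrite {2}(divn_eq i r.*2) oddD oddM odd_double andbF.
have halfm i : (i %% r.*2)./2 = i./2 %% r.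
  by rewrite -!divn2 -muln2 divn_modl ?dvdn_mull ?mulnK.
apply/andP/eqP=> [[/eqP ojk /eqP hjk]|ejk].
  by rewrite -(odd_double_half (j %% _)) -[RHS]odd_double_half !oddm !halfm ojk hjk.
by rewrite -!halfm ejk -[odd j]oddm ejk oddm.
Qed.

Lemma enum_labels_eq j k : (enum_labels j == enum_labels k) = (j == k %[mod r.*2]).
Proof. by rewrite (inj_eq (can_inj gK)) label_eq. Qed.

Lemma enum_labels_surj x : exists k, x = enum_labels k.
Proof.
rewrite /enum_labels -(fK x); case: (f x) => i.
  by exists i.*2.+1; rewrite /label /= odd_double /= uphalf_double idx_ord.
by exists i.*2; rewrite /label odd_double doubleK idx_ord.
Qed.

Notation u := enum_labels.

Lemma f_spoke k : f (spoke u k) = inr (idx r2 k).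
Proof. by rewrite gK /label odd_double doubleK. Qed.

Lemma f_rimel k : f (rimel u k) = inl (idx r2 k).
Proof. by rewrite gK /label /= odd_double /= uphalf_double. Qed.

Lemma f_rims : f @: rims r u = rim r.
Proof.
rewrite -imset_comp; apply/setP=> x; apply/imsetP/imsetP=> -[i _ ->]; exists i => //.
  by rewrite /= f_rimel idx_ord.
by rewrite /= f_rimel idx_ord.
Qed.

Lemma rims_basis : rims r u \in bases P.
Proof. by rewrite -whirlP f_rims !inE eqxx. Qed.

Lemma whirl_card B : B \in bases P -> #|B| = r.
Proof.
move=> BP; rewrite (card_bases BP rims_basis).
by rewrite (card_rims enum_labels_eq).
Qed.

(** The image of [A] is acyclic in the wheel or, for [r = 2], possibly the rim, which the whirl
    makes a basis. *)
Lemma small_rank (A : {set E}) : #|A| <= 2 -> rank P A = #|A|.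
Proof.
move=> A2; suff [B BW sAB] : exists2 B, B \in whirl r & f @: A \subset B.
  apply: (@rank_indep _ _ _ (f @^-1: B)); first by rewrite -whirlP (imset_preimset_can _ gK).
  by rewrite -sub_imset_pre.
have cA : #|f @: A| <= 2 by rewrite card_imset //; apply: can_inj fK.
have [/acyclic_extend[B BW sAB]|->] := wheel_small_acyclic r2 cA.
  by exists B; rewrite // inE BW orbT.
by exists (rim r); rewrite // !inE eqxx.
Qed.

Lemma triangle_dependent i B : B \in bases P -> triangle u i \subset B -> False.
Proof.
rewrite -whirlP => BW /(imsetS f).
have -> : f @: triangle u i = [set inr (idx r2 i); inl (idx r2 i); inr (idx r2 i.+1)].
  by rewrite !imsetU !imset_set1 !f_spoke f_rimel.
move=> sTB; have := BW; rewrite !inE => /orP[/eqP eB|/maxsetp].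
  by have := subsetP sTB (inr (idx r2 i)); rewrite eB inr_rim !inE eqxx => /(_ isT).
by rewrite (acyclicPn (triangle_is_cycle r2 i) sTB).
Qed.

Lemma whirl_triangle_rank i : rank P (triangle u i) <= 2.
Proof.
have le3 : #|triangle u i| <= 3 by rewrite /triangle setUC !cardsU1 !cards1;
  do 2 case: (_ \notin _).
rewrite leqNgt; apply/negP=> h; have e : rank P (triangle u i) = #|triangle u i|.
  by apply/eqP; rewrite eqn_leq rank_le_card (leq_trans le3).
by have [B BP] := indep_of_rank e; apply: triangle_dependent.
Qed.

(** Two elements of a triangle are independent by [small_rank] and the whole triangle has rank at
    most 2, so any two span the third. *)
Lemma whirl_triangular : triangular u P.
Proof.
have pair x y z i : x != y -> x \in triangle u i -> y \in triangle u i ->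
    z \in triangle u i -> z \in mspan P [set x; y].
  move=> xy xT yT zT; apply: (span_of_rank _ zT); first by rewrite subUset !sub1set xT.
  by rewrite [leqRHS]small_rank cards2 xy // whirl_triangle_rank.
have nst i j : spoke u i != rimel u j by apply: (spoke_rimel_neq r2 enum_labels_eq).
move=> i; split; apply: (pair _ _ _ i); rewrite ?inE ?eqxx ?orbT //.
- by rewrite eq_sym.
- exact: (spokeS_neq r2 enum_labels_eq).
Qed.

End WhirlLabels.

(** * Cyclic order and linear order *)

Section Alignment.
Variables (d : Order.disp_t) (E : finOrderType d) (r : nat) (u : nat -> E).
Hypothesis r2 : 2 <= r.
Hypothesis u_eq : forall j k, (u j == u k) = (j == k %[mod r.*2]).
Hypothesis u_surj : forall x, exists k, x = u k.
Implicit Types (X P : matroid E) (x y a b : E).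

Notation n := (r.*2).

Definition pos x : nat := Order.enum_rank x.

Lemma ltn_pos x : pos x < n.
Proof. by rewrite -(card_ground r2 u_eq u_surj) ltn_ord. Qed.

Lemma pos_inj : injective pos.
Proof. by move=> x y /val_inj/Order.EnumVal.enum_rank_inj. Qed.

Lemma lt_pos x y : (x < y)%O = (pos x < pos y).
Proof. exact: lt_enum_rank. Qed.

Lemma le_pos x y : (x <= y)%O = (pos x <= pos y).
Proof. by rewrite leNgt lt_pos -leqNgt. Qed.

Lemma pos_surj k : k < n -> exists x, pos x = k.
Proof.
rewrite -(card_ground r2 u_eq u_surj) => kn; exists (Order.enum_val (Ordinal kn)).
by rewrite /pos Order.EnumVal.enum_valK.
Qed.

(** The number of cyclic steps from [a] to [x], which turns [cyc_le a] into a comparison of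
    numbers. *)
Definition offset a x := (pos x + (n - pos a)) %% n.

Lemma offsetE a x : offset a x = if pos a <= pos x then pos x - pos a else pos x + n - pos a.
Proof.
rewrite /offset; have := ltn_pos a; have := ltn_pos x; case: ifP => h hx ha.
  rewrite (_ : _ + _ = pos x - pos a + n) ?modnDr ?modn_small //; lia.
rewrite modn_small; lia.
Qed.

Lemma cyc_le_offset a x y : cyc_le a x y = (offset a x <= offset a y).
Proof.
rewrite /cyc_le !le_pos !offsetE; have := ltn_pos a; have := ltn_pos x; have := ltn_pos y.
by case: (leqP (pos a) (pos x)); case: (leqP (pos a) (pos y)) => /=; lia.
Qed.

Lemma offset_uniq a x k : k < n -> pos a + k = pos x %[mod n] -> offset a x = k.
Proof.
move=> kn e; rewrite /offset -modnDml -e modnDml addnAC subnKC; last exact/ltnW/ltn_pos.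
by rewrite modnDl modn_small.
Qed.

(** Rotation or reversal; the reversed case adds [k] on the left to avoid truncated subtraction. *)
Definition aligned := (exists c, forall k, pos (u k) = c + k %[mod n]) \/
  (exists c, forall k, pos (u k) + k = c %[mod n]).

Lemma aligned_interval : aligned ->
  (forall l m, m < n -> cyc_interval (u l) (u (l + m)) = uarc u l m.+1) \/
  (forall l m, m < n -> cyc_interval (u (l + m)) (u l) = uarc u l m.+1).
Proof.
case=> -[c uc]; [left | right] => l m mn; apply/setP=> x; have [j ->] := u_surj x;
  have [k kn ->] := u_window r2 u_eq l j; rewrite (mem_uarc u_eq) // inE cyc_le_offset.
  have off i : i < n -> offset (u l) (u (l + i)) = i.
    by move=> lt_in; apply: offset_uniq => //; rewrite -modnDml !uc modnDml addnA.
  by rewrite !off.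
have off i : i <= m -> offset (u (l + m)) (u (l + i)) = m - i.
  move=> im; apply: offset_uniq; first by lia.
  apply/eqP; rewrite -(eqn_modDr (l + i)) uc -(uc (l + m)); apply/eqP; congr (_ %% _); lia.
have off0 := off 0 isT; rewrite addn0 subn0 in off0; rewrite off0 ltnS;
  have [km|mk] := leqP k m; first by rewrite off //; lia.
(* In the reversed order an element past position [m] is reached from [u (l + m)] after wrapping
   around, at an offset larger than [m]. *)
rewrite (@offset_uniq _ _ (n + m - k)); [lia|lia|].
apply/eqP; rewrite -(eqn_modDr (l + k)) uc -(uc (l + m)) -[X in X == _]modnDr.
by apply/eqP; rewrite modnDr -[RHS]modnDr; congr (_ %% _); lia.
Qed.

Lemma aligned_envelope P X : aligned -> arc_ranked r u P ->
  X \in positroid_envelope P <-> arc_ranked r u X.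
Proof.
move=> al aP; have aint := aligned_interval al; split=> [/envelope_rankP XP|aX].
  (* Cyclic intervals are never empty, so the arc of length 0 is treated apart. *)
  move=> a [|m] mr; last first.
    by case: aint => aint; rewrite -aint // XP aint // aP.
  rewrite uarc0 /arc_rank sub0set cards0; apply/eqP; rewrite -leqn0.
  by apply: leq_trans (rank_le_card _ _) _; rewrite cards0.
apply/envelope_rankP => a b; have [j ->] := u_surj a; have [k ->] := u_surj b.
case: aint => aint.
  by have [l ln ->] := u_window r2 u_eq j k; rewrite aint // aX // aP.
by have [l ln ->] := u_window r2 u_eq k j; rewrite aint // aX // aP.
Qed.

Lemma nxt_proof x : exists y, pos y == (pos x).+1 %% n.
Proof.
have [|y <-] := @pos_surj ((pos x).+1 %% n); first by rewrite ltn_pmod; lia.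
by exists y.
Qed.

Definition nxt x := xchoose (nxt_proof x).

Lemma pos_nxt x : pos (nxt x) = (pos x).+1 %% n.
Proof. exact/eqP/(xchooseP (nxt_proof x)). Qed.

Lemma nxt_inj : injective nxt.
Proof.
move=> x y /(congr1 pos); rewrite !pos_nxt => /eqP.
rewrite -addn1 -[(pos y).+1]addn1 eqn_modDr !modn_small ?ltn_pos // => /eqP.
exact: pos_inj.
Qed.

Definition linked x y := (nxt x == y) || (nxt y == x).

Lemma linkedC x y : linked x y = linked y x.
Proof. by rewrite /linked orbC. Qed.

(** The first step fixes the direction; a later step cannot turn back because [u k] and [u k.+2]
    differ. *)
Lemma linked_aligned : (forall k, linked (u k) (u k.+1)) -> aligned.
Proof.
move=> lk.
have neq2 k : u k != u k.+2.
  by rewrite u_eq; have := eqn_modDl k 0 2 n; rewrite addn0 addn2 => ->;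
    rewrite !modn_small //; lia.
have [/eqP h0|h0] := boolP (nxt (u 0) == u 1).
  have h k : nxt (u k) = u k.+1.
    elim: k => // k IH; have /orP[/eqP //|/eqP h] := lk k.+1.
    by have := neq2 k; rewrite -(inj_eq nxt_inj) IH h eqxx.
  left; exists (pos (u 0)); elim=> [|k IH]; first by rewrite addn0.
  by rewrite -h pos_nxt modn_mod -addn1 -modnDml IH modnDml addn1 addnS.
have h k : nxt (u k.+1) = u k.
  elim: k => [|k IH]; first by have := lk 0; rewrite /linked (negPf h0) => /eqP.
  have /orP[/eqP h|/eqP //] := lk k.+1.
  by have := neq2 k; rewrite -IH h eqxx.
right; exists (pos (u 0)); elim=> [|k IH]; first by rewrite addn0.
by rewrite -IH -(h k) pos_nxt modnDml addSnnS.
Qed.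

(** For [x] different from both, this tells whether [x] lies between [a] and [c]; the two values are
    the two arcs that [a] and [c] cut from the cyclic order. *)
Definition side a c x := (a < x)%O (+) (c < x)%O.

(* The successors of two exits of [T] would lie on different sides of the exits. *)
Lemma unique_exit (T : {set E}) a c : a \in T -> c \in T -> a != c ->
  (forall x y, x \notin T -> y \notin T -> side a c x = side a c y) ->
  nxt a \in T \/ nxt c \in T.
Proof.
move=> aT cT ac sd; apply/orP; rewrite -[_ || _]negbK negb_or; apply/negP=> /andP[na nc].
have ne x y : x \in T -> y \notin T -> pos x != pos y.
  by move=> xT yT; apply: contraNneq yT => /pos_inj <-.
have := sd _ _ na nc; rewrite /side !lt_pos.
have := ne _ _ aT na; have := ne _ _ aT nc; have := ne _ _ cT na; have := ne _ _ cT nc.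
have : pos a != pos c by apply: contraNneq ac => /pos_inj ->.
rewrite !pos_nxt; have := ltn_pos a; have := ltn_pos c.
have sE k : k < n -> k.+1 %% n = if k.+1 == n then 0 else k.+1 by apply: succE; lia.
move=> hc ha; rewrite !sE //; case: ((pos a).+1 =P n) => e1; case: ((pos c).+1 =P n) => e2;
  do ?(case: ltnP => ?) => /=; lia.
Qed.

(** If the successor of [x] leaves [T], those of [y] and [z] stay in it. Unless one of them is [x],
    [nxt] swaps [y] and [z], impossible with at least four elements. *)
Lemma three_linked x y z (T := [set x; y; z]) : x != y -> x != z -> y != z ->
  (forall a c, a \in T -> c \in T -> a != c -> nxt a \in T \/ nxt c \in T) ->
  linked x y || linked x z.
Proof.
have nn w : (nxt w == w) = false.
  apply/eqP=> /(congr1 pos); rewrite pos_nxt => /eqP.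
  have := ltn_pos w => wn;
    rewrite -[X in _ == X](modn_small wn) -addn1 -[X in _ == X %[mod _]]addn0.
  by rewrite eqn_modDl !modn_small //; lia.
have n2 w : (nxt (nxt w) == w) = false.
  apply/eqP=> /(congr1 pos); rewrite !pos_nxt => /eqP.
  have := ltn_pos w => wn; rewrite -[X in _ == X](modn_small wn) -addn1 modnDml.
  rewrite addn1 -addn2 -[X in _ == X %[mod _]]addn0.
  by rewrite eqn_modDl !modn_small //; lia.
move=> xy xz yz ex; have [xT yT zT] : [/\ x \in T, y \in T & z \in T].
  by rewrite !inE !eqxx ?orbT.
rewrite /linked; have [nx|nx] := boolP (nxt x \in T).
  by move: nx; rewrite !inE nn /= => /orP[] ->; rewrite ?orbT.
have [/(negP nx)//|ny] := ex x y xT yT xy; have [/(negP nx)//|nz] := ex x z xT zT xz.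
move: ny nz; rewrite !inE !nn ?orbF /= => /orP[->|/eqP ny]; first by rewrite ?orbT.
move=> /orP[->|/eqP nz]; first by rewrite ?orbT.
by have := n2 y; rewrite ny nz eqxx.
Qed.

End Alignment.

(** * Bases built from a triangle and a vertex star *)

Section TriangleSpans.
Variables (E : finType) (r : nat) (u : nat -> E).
Hypothesis r2 : 2 <= r.
Hypothesis u_eq : forall j k, (u j == u k) = (j == k %[mod r.*2]).
Hypothesis u_surj : forall x, exists k, x = u k.
Variable P : matroid E.
Hypothesis P_card : forall B, B \in bases P -> #|B| = r.
Hypothesis triP : triangular u P.
Notation rims := (rims r u).

Lemma triangle_span i x y : x \in triangle u i -> y \in triangle u i -> x != y ->
  triangle u i \subset mspan P [set x; y].
Proof.
have [h1 h2 h3] := triP i.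
have sub a b c : c \in mspan P [set a; b] ->
    {subset [set a; b; c] <= mspan P [set a; b]}.
  move=> cab w; rewrite !inE => /orP[ab|/eqP ->]; last by move: cab; rewrite inE.
  by have := sub_mspan P [set a; b]; move/subsetP/(_ w); rewrite !inE => /(_ ab).
have s12 : triangle u i \subset mspan P [set spoke u i; rimel u i].
  by apply/subsetP=> w wT; apply: (sub _ _ _ h1).
have s23 : triangle u i \subset mspan P [set rimel u i; spoke u i.+1].
  by apply/subsetP=> w wT; apply: (sub _ _ _ h2);
    move: wT; rewrite !inE => /orP[/orP[]|] ->; rewrite ?orbT.
have s13 : triangle u i \subset mspan P [set spoke u i; spoke u i.+1].
  by apply/subsetP=> w wT; apply: (sub _ _ _ h3);
    move: wT; rewrite !inE => /orP[/orP[]|] ->; rewrite ?orbT.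
rewrite {1 2}/triangle !inE => /orP[/orP[]|] /eqP -> /orP[/orP[]|] /eqP ->;
  by rewrite ?eqxx // [X in mspan P X]setUC.
Qed.

Lemma spokes_card : #|~: rims| = r.
Proof. by have := cardsC rims; rewrite (card_rims u_eq) (card_ground r2 u_eq u_surj); lia. Qed.

(** The three edges at the rim vertex of [spoke u j.+1]; consecutive stars share a rim element. *)
Definition star j := [set rimel u j; spoke u j.+1; rimel u j.+1].

(* [K] and one more element of the triangle span the hyperplane complementary to
   the star of the vertex of [spoke j.+1]. *)
Lemma star_basis i j x z b (K := z |: ((~: rims) :\: (spoke u j.+1 |: triangle u i))) :
  spoke u j.+1 \notin triangle u i -> x \in triangle u i -> z \in triangle u i -> x != z ->
  b \in star j -> #|K| <= r - 2 -> x |: (b |: K) \in bases P.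
Proof.
move=> jT xT zT xz bj cK; pose A := x |: (b |: K); rewrite -/A.
have subT : triangle u i \subset mspan P A.
  apply: subset_trans (triangle_span xT zT xz) _; apply: mspan_sub.
  by rewrite subUset !sub1set !mem_mspan // !inE eqxx ?orbT.
have sp k : spoke u k != spoke u j.+1 -> spoke u k \in mspan P A.
  move=> kj; have [/(subsetP subT)//|kT] := boolP (spoke u k \in triangle u i).
  rewrite mem_mspan // /A /K in_setU1 in_setU1 in_setU1 in_setD in_setC in_setU1.
  by rewrite (negPf kj) kT (spoke_rims r2 u_eq) ?orbT.
have [h1 _ _] := triP j; have [_ h2 _] := triP j.+1.
have bA : b \in mspan P A by rewrite mem_mspan // !inE eqxx orbT.
have neqS k : spoke u k != spoke u k.+1 by apply: (spokeS_neq r2 u_eq).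
(* Whichever element of the star [b] is, it yields the missing spoke, with the help of at most one
   neighbouring spoke. *)
have sj : spoke u j.+1 \in mspan P A.
  have : [|| b == rimel u j, b == spoke u j.+1 | b == rimel u j.+1].
    by move: bj; rewrite !inE orbA.
  case/or3P=> /eqP e; rewrite e in bA => //.
  - by apply: span_closed h1 _; rewrite subUset !sub1set bA sp.
  by apply: span_closed h2 _; rewrite subUset !sub1set bA sp // eq_sym.
have all_sp k : spoke u k \in mspan P A.
  by have [->|] := eqVneq (spoke u k) (spoke u j.+1); [|apply: sp].
have rkA : r <= rank P A.
  rewrite -(rank_setT P_card); apply: rank_sub_span; apply/subsetP=> y _.
  case: (eltP u_surj y) => -[k ->]; first exact: all_sp.
  by have [_ _ h3] := triP k; apply: span_closed h3 _; rewrite subUset !sub1set !all_sp.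
have cA : #|A| <= r.
  have c1 (w : E) (S : {set E}) : #|w |: S| <= #|S|.+1 by rewrite cardsU1; case: (_ \notin _).
  by have := c1 x (b |: K); have := c1 b K; rewrite -/A; move: #|A| #|b |: K| #|K| cK;
    clear - r2; lia.
have [B BP] := bases_nonempty P; have cB := P_card BP.
by apply: (basis_of_rank BP); rewrite cB //; apply/eqP;
  rewrite eqn_leq cA (leq_trans rkA) ?rank_le_card.
Qed.

(** Of the [r] spokes, [spoke u j] and the two in the triangle are removed, and [z] is added. *)
Lemma star_card i j z : spoke u j \notin triangle u i -> z \in triangle u i ->
  #|z |: ((~: rims) :\: (spoke u j |: triangle u i))|.+2 = r.
Proof.
move=> jT zT; rewrite cardsU1 in_setD in_setU1 zT orbT /=.
pose S := [set spoke u j; spoke u i; spoke u i.+1].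
have cS : #|S| = 3.
  rewrite /S setUC !cardsU1 cards1 !inE.
  move: jT; rewrite !inE !negb_or => /andP[/andP[n1 _] n3].
  by rewrite (negPf n1) eq_sym (negPf n3) eq_sym (negPf (spokeS_neq r2 u_eq i)).
have -> : (~: rims) :\: (spoke u j |: triangle u i) = (~: rims) :\: S.
  apply/setP=> y; rewrite !inE; case: (eltP u_surj y) => -[k ->]; last first.
    by rewrite (rimel_rims r2 u_eq) !andbF.
  by rewrite (negPf (spoke_rimel_neq r2 u_eq k i)) orbF !orbA.
have sS : S \subset ~: rims.
  by apply/subsetP=> y; rewrite !inE => /orP[/orP[]|] /eqP ->; rewrite (spoke_rims r2 u_eq).
have := cardsID S (~: rims); rewrite (setIidPr sS) spokes_card cS; lia.
Qed.

End TriangleSpans.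

(** * The linear order of a positroid whirl *)

Section PositroidOrder.
Variables (R : realType) (d : Order.disp_t) (E : finOrderType d) (r : nat) (u : nat -> E).
Hypothesis r3 : 3 <= r.
Let r2 : 2 <= r := ltnW r3.
Hypothesis u_eq : forall j k, (u j == u k) = (j == k %[mod r.*2]).
Hypothesis u_surj : forall x, exists k, x = u k.
Variable P : matroid E.
Hypothesis P_card : forall B, B \in bases P -> #|B| = r.
Hypothesis triP : triangular u P.
Hypothesis posP : positroid R P.
Notation rims := (rims r u).
Notation nxt := (nxt r2 u_eq u_surj).
Notation linked := (linked r2 u_eq u_surj).
Notation spoke := (spoke u).
Notation rimel := (rimel u).
Notation triangle := (triangle u).

Lemma modr_neq i k l : k < r -> l < r -> k != l -> (i + k == i + l %[mod r]) = false.
Proof. by move=> kr lr kl; rewrite eqn_modDl !modn_small // (negPf kl). Qed.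

Lemma spoke_neq i k l : k < r -> l < r -> k != l -> (spoke (i + k) == spoke (i + l)) = false.
Proof. by move=> kr lr kl; rewrite (spoke_eq u_eq) modr_neq. Qed.

Lemma rimel_neq i k l : k < r -> l < r -> k != l -> (rimel (i + k) == rimel (i + l)) = false.
Proof. by move=> kr lr kl; rewrite (rimel_eq u_eq) modr_neq. Qed.

Lemma triangle_uniq i : [/\ spoke i != rimel i, spoke i != spoke i.+1 & rimel i != spoke i.+1].
Proof.
split; rewrite ?(spoke_rimel_neq r2 u_eq) ?(spokeS_neq r2 u_eq) //.
by rewrite eq_sym (spoke_rimel_neq r2 u_eq).
Qed.

Lemma card_triangle i : #|triangle i| = 3.
Proof.
have [h1 h2 h3] := triangle_uniq i.
by rewrite /triangle setUC !cardsU1 cards1 !inE ![spoke i.+1 == _]eq_sym (negPf h1) (negPf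
  h2) (negPf h3).
Qed.

(** [K] contains [z], so adding [a] and [c] completes the dependent triangle, while one element of
    the triangle and one of the star complete [K] to a basis by [star_basis]. Hence
    [positroid_noncrossing] applies. *)
Lemma same_side i j a c z b e : a \in triangle i -> c \in triangle i -> z \in triangle i ->
  a != c -> a != z -> c != z -> spoke j.+1 \notin triangle i ->
  b \in star u j -> e \in star u j -> side a c b = side a c e.
Proof.
move=> aT cT zT ac az cz jT bj ej.
pose K := z |: ((~: rims) :\: (spoke j.+1 |: triangle i)).
have cK : #|K|.+2 = r := star_card r2 u_eq u_surj jT zT.
have cK2 : #|K| <= r - 2 by lia.
apply: (positroid_noncrossing (K := K) posP).
- by move=> B /P_card ->; rewrite -cK.
- apply/negP=> acP; have : rank P (triangle i) <= 2.
    apply: leq_trans (rank_sub_span (triangle_span triP aT cT ac)) _.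
    by apply: leq_trans (rank_le_card _ _) _; rewrite cards2 ac.
  have eT : [set a; c; z] = triangle i.
    apply/eqP; rewrite eqEcard card_triangle setUC !cardsU1 cards1 !inE.
    rewrite ![z == _]eq_sym (negPf ac) (negPf az) (negPf cz) /= andbT.
    by rewrite !subUset !sub1set aT cT zT.
  rewrite (rank_indep acP) ?card_triangle // -eT !subUset !sub1set.
  by rewrite !inE !eqxx ?orbT.
- exact: (star_basis r2 u_eq u_surj P_card triP).
exact: (star_basis r2 u_eq u_surj P_card triP).
Qed.

Lemma side_const i a c x y : a \in triangle i -> c \in triangle i -> a != c ->
  x \notin triangle i -> y \notin triangle i -> side a c x = side a c y.
Proof.
move=> aT cT ac xT yT; have [z zT] : exists2 z, z \in triangle i & z \notin [set a; c].
  apply/subsetPn/negP=> /subset_leq_card; rewrite card_triangle cards2 ac //.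
rewrite !inE negb_or => /andP[za zc].
have sp l : 2 <= l -> l < r -> spoke (i + l) \notin triangle i.
  move=> l2 lr; have := @spoke_neq i l 0 lr; have := @spoke_neq i l 1 lr.
  rewrite addn0 addn1 => h1 h0; rewrite !inE h0 ?h1 ?gtn_eqF // ?(ltnW l2) ?(ltnW r2) //.
  by rewrite (negPf (spoke_rimel_neq r2 u_eq _ _)).
(* In this range [star u (i + l)] is at the vertex of [spoke (i + l.+1)], which is off the triangle;
   the shared rim elements then chain these stars together. *)
have step l w : 1 <= l -> l.+1 < r -> w \in star u (i + l) -> side a c w = side a c (rimel
  (i + l)).
  move=> l1 lr wS; apply: (same_side aT cT zT ac _ _ _ wS); rewrite 1?[_ == z]eq_sym //.
    by rewrite -addnS sp.
  by rewrite !inE eqxx.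
have rm l : 1 <= l -> l < r -> side a c (rimel (i + l)) = side a c (rimel i.+1).
  elim: l => // -[|l] IH _ lr; first by rewrite addn1.
  rewrite -IH // ?(ltnW lr) //; apply: step => //.
  by rewrite !inE addnS eqxx !orbT.
suff h w : w \notin triangle i -> side a c w = side a c (rimel i.+1) by rewrite (h x xT) (h
  y yT).
case: (eltP u_surj w) => -[k ->]; have [l [lr es er]] := index_window r2 u_eq i k;
  rewrite ?es ?er {es er} => wT.
  case: l lr wT => [|[|l]] lr wT.
  - by rewrite !inE addn0 eqxx in wT.
  - by rewrite !inE addn1 eqxx !orbT in wT.
  rewrite -(rm l.+1) // ?(ltnW lr) //; apply: step => //.
  by rewrite !inE addnS eqxx ?orbT.
case: l lr wT => [|l] lr wT; first by rewrite !inE addn0 eqxx orbT in wT.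
exact: rm.
Qed.

Lemma triangle_exit i a c : a \in triangle i -> c \in triangle i -> a != c ->
  nxt a \in triangle i \/ nxt c \in triangle i.
Proof.
move=> aT cT ac; apply: (unique_exit _ _ _ aT cT ac) => x y xT yT;
  exact: (side_const aT cT ac xT yT).
Qed.

(** In cyclic order [x] has just one predecessor and one successor. *)
Lemma linked3 x a b c : linked x a -> linked x b -> linked x c -> [|| a == b, a == c | b == c].
Proof.
have inj w v : nxt w = x -> nxt v = x -> w = v by move=> <- /nxt_inj.
move=> /orP[] /eqP ha /orP[] /eqP hb /orP[] /eqP hc; first
  [ by rewrite -ha -hb eqxx | by rewrite -ha -hc eqxx orbT | by rewrite -hb -hc eqxx !orbT
  | by rewrite (inj _ _ ha hb) eqxx | by rewrite (inj _ _ ha hc) eqxx orbT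
  | by rewrite (inj _ _ hb hc) eqxx !orbT ].
Qed.

Lemma triangle_linked i x y z : triangle i = [set x; y; z] -> x != y -> x != z -> y != z ->
  linked x y || linked x z.
Proof.
by move=> eT xy xz yz; apply: three_linked => // a c; rewrite -eT; apply: triangle_exit.
Qed.

Lemma set3C (x y z : E) : [set x; y; z] = [set y; x; z].
Proof. by rewrite (setUC [set x]). Qed.

Lemma set3_rev (x y z : E) : [set x; y; z] = [set z; y; x].
Proof. by rewrite set3C setUAC set3C setUAC set3C setUAC. Qed.

(* Otherwise one of the two spokes is linked to both other elements of this
   triangle and to an element of the adjacent triangle. *)
Lemma spokes_unlinked i : ~~ linked (spoke i) (spoke i.+1).
Proof.
apply/negP=> lss; have [st ss ts] := triangle_uniq i.
have nst k l : (spoke k == rimel l) = false by apply/negbTE/(spoke_rimel_neq r2 u_eq).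
have nts k l : (rimel l == spoke k) = false by rewrite eq_sym nst.
have /orP[lts|lts] : linked (rimel i) (spoke i) || linked (rimel i) (spoke i.+1).
  by apply: (@triangle_linked i _ _ _ (set3C _ _ _)); rewrite // eq_sym.
  (* [i + r.-1] stands for the preceding triangle, whose last spoke is [spoke i]. Its first spoke
     differs from [spoke i.+1] because [3 <= r]. *)
  have [st' ss' ts'] := triangle_uniq (i + r.-1).
  have eS : spoke (i + r.-1).+1 = spoke i by rewrite -addnS prednK ?(spoke_periodic u_eq)
    //; lia.
  rewrite eS in ss' ts'.
  have /orP[l1|l1] : linked (spoke i) (rimel (i + r.-1)) || linked (spoke i) (spoke (i + r.-1)).
    apply: (@triangle_linked (i + r.-1)); rewrite 1?eq_sym //.
    by rewrite /triangle eS; apply: set3_rev.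
  - have := linked3 lss (etrans (linkedC _ _ _ _ _) lts) l1; rewrite ?nst ?nts /=.
    by rewrite -{1}(addn0 i) rimel_neq //; clear - r3; lia.
  have := linked3 lss (etrans (linkedC _ _ _ _ _) lts) l1; rewrite ?nst ?nts /=.
  by rewrite -{1}addn1 spoke_neq //; clear - r3; lia.
have [st' ss' ts'] := triangle_uniq i.+1.
rewrite linkedC in lss; rewrite linkedC in lts.
have /orP[l1|l1] : linked (spoke i.+1) (rimel i.+1) || linked (spoke i.+1) (spoke i.+2).
  exact: (@triangle_linked i.+1).
- have := linked3 lss lts l1; rewrite ?nst ?nts /=.
  by rewrite -{1}(addn0 i) -[i.+1]addn1 rimel_neq //; clear - r3; lia.
have := linked3 lss lts l1; rewrite ?nst ?nts /=.
by rewrite -{1}(addn0 i) -[i.+2]addn2 spoke_neq //; clear - r3; lia.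
Qed.

(** A spoke is linked to another element of its triangle; this is not the other spoke, so it is the
    rim element. *)
Lemma positroid_linked k : linked (u k) (u k.+1).
Proof.
rewrite -(odd_double_half k); set i := k./2; have [st ss ts] := triangle_uniq i.
case: (odd k); rewrite ?add0n ?add1n.
  have := @triangle_linked i (spoke i.+1) (rimel i) (spoke i).
  rewrite linkedC [linked _ (spoke i)]linkedC (negPf (spokes_unlinked i)) orbF; apply;
    rewrite 1?eq_sym //.
  exact: set3_rev.
have := @triangle_linked i (spoke i) (rimel i) (spoke i.+1).
by rewrite (negPf (spokes_unlinked i)) orbF; apply.
Qed.

Lemma positroid_aligned : aligned r u.
Proof. exact: linked_aligned positroid_linked. Qed.

End PositroidOrder.

(** * The four families of bases *)

Section BasisAxioms.
Variable T : finType.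
Implicit Types (k : nat) (S A B : {set T}) (Bs : {set {set T}}).

Lemma basis_axiomsI Bs : Bs != set0 ->
  (forall A B x, A \in Bs -> B \in Bs -> x \in A -> x \notin B ->
    exists y, [/\ y \in B, y \notin A & y |: (A :\ x) \in Bs]) -> basis_axioms Bs.
Proof.
move=> Bs0 ex; apply/andP; split=> //; apply/forall_inP=> A AB; apply/forall_inP=> B BB.
apply/forall_inP=> x; rewrite inE => /andP[xB xA]; apply/exists_inP.
by have [y [yB yA yBs]] := ex A B x AB BB xA xB; exists y; rewrite // inE yA.
Qed.

Lemma card_swap A x y : x \in A -> y \notin A -> #|y |: (A :\ x)| = #|A|.
Proof. by move=> xA yA; rewrite cardsU1 !inE (negPf yA) andbF (cardsD1 x A) xA. Qed.

Lemma card_swapD S A x y : x \in A -> y \notin A ->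
  #|(y |: (A :\ x)) :\: S| + (x \notin S) = #|A :\: S| + (y \notin S).
Proof.
move=> xA yA; rewrite (cardsD1 x (A :\: S)) (cardsD1 y (_ :\: S)) !inE xA eqxx /= andbT.
rewrite (_ : ((y |: A :\ x) :\: S) :\ y = (A :\: S) :\ x); first by rewrite andbT; lia.
apply/setP=> z; rewrite !inE; have [->|_] /= := eqVneq z y; rewrite ?(negPf yA) ?andbF //.
by case: (z \in S); rewrite ?andbF.
Qed.

Lemma setD_witness A B : #|A| = #|B| -> forall x, x \in A -> x \notin B ->
  exists2 y, y \in B & y \notin A.
Proof.
move=> cAB x xA xB; apply/subsetPn; apply: contra xB => sBA.
by have /eqP -> : B == A by rewrite eqEcard sBA cAB /=.
Qed.

(** The direct sum of a uniform matroid of rank [k - 1] on [S] and one of rank 1 off [S]: an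
    exchange can be made on the side of [x]. *)
Lemma basis_axioms_eq1 S k : (exists B : {set T}, (#|B| == k) && (#|B :\: S| == 1)) ->
  basis_axioms [set B : {set T} | (#|B| == k) && (#|B :\: S| == 1)].
Proof.
case=> B0 B0P; apply: basis_axiomsI; first by apply/set0Pn; exists B0; rewrite inE.
move=> A B x; rewrite !inE => /andP[/eqP cA /eqP cA1] /andP[/eqP cB /eqP cB1] xA xB.
suff [y [yB yA ySE]] : exists y, [/\ y \in B, y \notin A & (y \in S) = (x \in S)].
  exists y; split=> //; rewrite inE card_swap // cA eqxx /=.
  by have := card_swapD S xA yA; rewrite ySE cA1 => /addIn ->.
have [xS|xS] := boolP (x \in S).
  have cAB : #|A :&: S| = #|B :&: S|.
    by have := cardsID S A; have := cardsID S B; rewrite cA cB cA1 cB1; lia.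
  have [||y] := setD_witness cAB (x := x); rewrite ?inE ?xA ?(negPf xB) //.
  by case/andP=> yB yS; rewrite yS andbT; exists y.
have /cards1P[y ey] : #|B :\: S| == 1 by rewrite cB1.
have : y \in B :\: S by rewrite ey inE.
rewrite inE => /andP[yS yB]; exists y; rewrite (negPf yS); split=> //.
have /card_le1_eqP A1 : #|A :\: S| <= 1 by rewrite cA1.
apply: contra xB => yA; by rewrite (A1 y x) // inE ?xS ?yS ?xA ?yA.
Qed.

(** For [x] in [S] a replacement in [S] is preferred. If there is none, [B :&: S] is smaller than
    [A :&: S], so [A] has no element off [S] and any [y] may enter. *)
Lemma basis_axioms_le1 S k : (exists B : {set T}, (#|B| == k) && (#|B :\: S| <= 1)) ->
  basis_axioms [set B : {set T} | (#|B| == k) && (#|B :\: S| <= 1)].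
Proof.
case=> B0 B0P; apply: basis_axiomsI; first by apply/set0Pn; exists B0; rewrite inE.
move=> A B x; rewrite !inE => /andP[/eqP cA cA1] /andP[/eqP cB cB1] xA xB.
suff [y [yB yA ySE]] : exists y, [/\ y \in B, y \notin A &
    #|A :\: S| + (y \notin S) <= 1 + (x \notin S)].
  exists y; split=> //; rewrite inE card_swap // cA eqxx /=.
  by have := card_swapD S xA yA; lia.
have [xS|xS] := boolP (x \in S); last first.
  have [|y yB yA] := setD_witness _ xA xB; first by rewrite cA cB.
  by exists y; split=> //; case: (y \in S) => /=; lia.
have [sBA|/subsetPn[y]] := boolP (B :&: S \subset A); last first.
  by rewrite inE => /andP[yB yS] yA; exists y; rewrite yS; split=> //=; lia.
have lt : #|B :&: S| < #|A :&: S|.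
  apply/proper_card/properP; split; last by exists x; rewrite !inE ?xA // (negPf xB).
  by rewrite subsetI sBA subsetIr.
have [|y yB yA] := setD_witness _ xA xB; first by rewrite cA cB.
exists y; split=> //; have := cardsID S A; have := cardsID S B; rewrite cA cB.
by case: (y \in S) => /=; lia.
Qed.

End BasisAxioms.

Lemma isomorphic_card (E F : finType) (Bs : {set {set E}}) (Cs : {set {set F}}) :
  isomorphic Bs Cs -> #|Bs| = #|Cs|.
Proof.
case=> f [[g fK gK] fP]; rewrite -(card_imset (mem Bs) (imset_inj (can_inj fK))).
apply: eq_card => C; apply/imsetP/idP=> [[B BB ->]|CC]; first by rewrite fP.
have eC : f @: (f @^-1: C) = C by rewrite (imset_preimset_can _ gK).
by exists (f @^-1: C); rewrite // -fP eC.
Qed.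

(** * Exchange and counting for the four families *)

Section TriangularBases.
Variables (E : finType) (r : nat) (u : nat -> E).
Hypothesis r2 : 2 <= r.
Hypothesis u_eq : forall j k, (u j == u k) = (j == k %[mod r.*2]).
Hypothesis u_surj : forall x, exists k, x = u k.
Variable P : matroid E.
Hypothesis P_card : forall B, B \in bases P -> #|B| = r.
Hypothesis triP : triangular u P.
Notation rims := (rims r u).
Notation one := [set B : {set E} | one_spoke r u B].

Lemma spokes_spanning (A : {set E}) : #|A| = r -> (forall i, spoke u i \in mspan P A) -> A
  \in bases P.
Proof.
move=> cA spA; have [B BP] := bases_nonempty P.
have cB := P_card BP; apply: (basis_of_rank BP); rewrite cB // -(rank_setT P_card).
apply: rank_sub_span.
apply/subsetP=> x _; case: (eltP u_surj x) => -[i ->] //.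
by have [_ _ h] := triP i; apply: span_closed h _; rewrite subUset !sub1set !spA.
Qed.

Lemma all_spokes_basis : ~: rims \in bases P.
Proof.
apply: spokes_spanning; first exact: (spokes_card r2 u_eq u_surj).
by move=> i; rewrite mem_mspan // inE (spoke_rims r2 u_eq).
Qed.

Lemma swapped_spokes_basis : rimel u 0 |: (~: rims :\ spoke u 0) \in bases P.
Proof.
apply: spokes_spanning.
  by rewrite card_swap ?(spokes_card r2 u_eq u_surj) // !inE ?(spoke_rims r2 u_eq)
    ?(rimel_rims r2 u_eq).
have sp i : spoke u i != spoke u 0 -> spoke u i \in mspan P (rimel u 0 |: (~: rims :\ spoke
  u 0)).
  by move=> i0; rewrite mem_mspan // !inE i0 (spoke_rims r2 u_eq) orbT.
move=> i; have [->|] := eqVneq (spoke u i) (spoke u 0); last exact: sp.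
have [_ h _] := triP 0; apply: span_closed h _.
rewrite subUset !sub1set sp ?andbT; last by rewrite eq_sym (spokeS_neq r2 u_eq).
by rewrite mem_mspan // !inE eqxx.
Qed.

Lemma basis_axioms_one_spoke : basis_axioms one.
Proof.
apply: (@basis_axioms_eq1 _ rims r); exists (spoke u 0 |: (rims :\ rimel u 0)).
exact: (one_spokeI r2 u_eq).
Qed.

Lemma basis_axioms_one_spoke_relaxed : basis_axioms (rims |: one).
Proof.
suff -> : rims |: one = [set B : {set E} | (#|B| == r) && (#|B :\: rims| <= 1)].
  apply: basis_axioms_le1; exists rims.
  by rewrite (card_rims u_eq) eqxx setDv cards0.
apply/setP=> B; rewrite !inE /one_spoke leq_eqVlt ltnS leqn0 cards_eq0 setD_eq0 andb_orr orbC.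
congr (_ || _); apply/eqP/andP=> [->|[/eqP cB sB]].
  by rewrite (card_rims u_eq) eqxx.
by apply/eqP; rewrite eqEcard sB (card_rims u_eq) cB /=.
Qed.

(** The only bad exchange is one that produces the rim. Then [A :\ x] lies in the rim, and an
    element [z] of [B] off the rim gives instead a set with exactly one spoke, still a basis of
    [P]. *)
Lemma basis_axioms_unrelaxed : rims \in bases P -> basis_axioms (bases P :\ rims).
Proof.
move=> RP; apply: basis_axiomsI.
  apply/set0Pn; exists (~: rims); rewrite !inE all_spokes_basis andbT.
  by apply/eqP=> e; have := spoke_rims r2 u_eq 0; rewrite -e inE (spoke_rims r2 u_eq).
move=> A B x; rewrite !inE => /andP[AR AP] /andP[BR BP] xA xB.
have [y [yB yA yP]] := exchange AP BP xA xB.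
have [eR|nR] := eqVneq (y |: A :\ x) rims; last by exists y; rewrite !inE nR.
have [z zB zR] : exists2 z, z \in B & z \notin rims.
  apply/subsetPn; apply: contra BR => sB.
  by rewrite eqEcard sB (card_rims u_eq) P_card /=.
have AxR w : w \in A -> w != x -> w \in rims by move=> wA wx; rewrite -eR !inE wx wA orbT.
have zA : z \notin A.
  apply/negP=> zA; have [zx|zx] := eqVneq z x; first by rewrite zx (negPf xB) in zB.
  by rewrite (AxR z zA zx) in zR.
exists z; split=> //; rewrite !inE; apply/andP; split.
  by apply: contraNneq zR => <-; rewrite !inE eqxx.
apply: (triangular_one_spoke r2 u_eq u_surj P_card triP).
rewrite /one_spoke card_swap // P_card // eqxx; apply/cards1P; exists z.
apply/setP=> w; rewrite !inE; have [->|wz] := eqVneq w z; first by rewrite zR.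
have [->|wx] := eqVneq w x; rewrite /= ?andbF //.
by have [/AxR -> //|] := boolP (w \in A); rewrite ?andbF.
Qed.

Lemma one_spoke_proper : rims \notin one.
Proof. by rewrite inE /one_spoke setDv cards0 andbF. Qed.

Lemma one_spoke_sub : one \subset bases P :\ rims.
Proof.
apply/subsetP=> B oB; rewrite !inE; apply/andP; split.
  by apply: contraNneq one_spoke_proper => <-.
by apply: (triangular_one_spoke r2 u_eq u_surj P_card triP); rewrite inE in oB.
Qed.

Lemma all_spokes_not_one : ~: rims \notin one.
Proof.
rewrite inE /one_spoke negb_and setDE setIid (spokes_card r2 u_eq u_surj); lia.
Qed.

Lemma all_spokes_neq : ~: rims != rims.
Proof.
by apply/eqP=> e; have := spoke_rims r2 u_eq 0; rewrite -e inE (spoke_rims r2 u_eq).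
Qed.

(** Two bases outside [one], with [r] and [r - 1] spokes, outweigh the added rim. For [r = 2] the
    second has one spoke and the two numbers coincide. *)
Lemma card_one_spoke_lt : 3 <= r -> rims \in bases P -> #|rims |: one| < #|bases P :\ rims|.
Proof.
move=> r3 RP; rewrite cardsU1 one_spoke_proper.
set S' := rimel u 0 |: (~: rims :\ spoke u 0).
have cS' : #|S' :\: rims| = r.-1.
  rewrite (_ : S' :\: rims = ~: rims :\ spoke u 0).
    by have := cardsD1 (spoke u 0) (~: rims);
      rewrite (spokes_card r2 u_eq u_surj) inE (spoke_rims r2 u_eq); lia.
  apply/setP=> x; rewrite !inE; have [->|_] := eqVneq x (rimel u 0).
    by rewrite (rimel_rims r2 u_eq) /= andbF.
  by case: (x \in rims); rewrite ?andbF.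
have S'S : ~: rims != S'.
  apply/eqP=> e; have : rimel u 0 \in S' by rewrite !inE eqxx.
  by rewrite -e inE (rimel_rims r2 u_eq).
have S'1 : S' \notin one by rewrite inE /one_spoke negb_and cS'; lia.
have S'R : S' != rims by apply/eqP=> e; move: cS'; rewrite e setDv cards0; lia.
have : #|~: rims |: (S' |: one)| <= #|bases P :\ rims|.
  apply: subset_leq_card; rewrite !subUset !sub1set one_spoke_sub !inE all_spokes_neq S'R.
  by rewrite all_spokes_basis swapped_spokes_basis.
by rewrite !cardsU1 in_setU1 (negPf S'S) all_spokes_not_one S'1; lia.
Qed.

End TriangularBases.

(* For [r = 2] the whirl is the uniform matroid U_{2,4}, so any bijection is an
   isomorphism, in particular the one that follows the order. *)
Lemma whirl2_uniform (E : finType) (P : matroid E) (h2 : 2 <= 2) (f : E -> 'I_2 + 'I_2) g :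
  cancel f g -> cancel g f -> (forall B : {set E}, (f @: B \in whirl 2) = (B \in bases P)) ->
  forall A, (A \in whirl 2) = (#|A| == 2).
Proof.
move=> fK gK whirlP A.
have finj (B : {set E}) : #|f @: B| = #|B| by rewrite card_imset //; apply: can_inj fK.
have cW C : C \in whirl 2 -> #|C| = 2.
  rewrite -(imset_preimset_can C gK) whirlP finj; exact: (whirl_card h2 gK whirlP).
apply/idP/eqP=> [/cW //|cA].
have [/acyclic_extend[B BW sAB]|->] := wheel_small_acyclic h2 (eq_leq cA).
  have BW' : B \in whirl 2 by rewrite inE BW orbT.
  by have /eqP -> : A == B by rewrite eqEcard sAB cA (cW B BW').
by rewrite !inE eqxx.
Qed.

Lemma whirl2_aligned (d : Order.disp_t) (E : finOrderType d) (P : matroid E) (h2 : 2 <= 2)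
    (f : E -> 'I_2 + 'I_2) g :
  cancel f g -> cancel g f -> (forall B : {set E}, (f @: B \in whirl 2) = (B \in bases P)) ->
  exists f' g', [/\ cancel f' g', cancel g' f',
    forall B : {set E}, (f' @: B \in whirl 2) = (B \in bases P)
    & aligned 2 (enum_labels h2 g')].
Proof.
move=> fK gK whirlP; have unif := whirl2_uniform h2 fK gK whirlP.
pose f' (x : E) := label h2 (pos x).
have pos4 (x : E) : pos x < 4 := ltn_pos h2 (enum_labels_eq h2 gK) (enum_labels_surj h2 fK) x.
have f'inj : injective f'.
  move=> x y /eqP; rewrite label_eq !modn_small // => /eqP; exact: pos_inj.
have [|g' f'K g'K] := inj_card_bij f'inj.
  by rewrite (bij_eq_card (Bijective fK gK)).
exists f', g'; split=> // [B|].
  rewrite unif (card_imset _ f'inj) -whirlP unif card_imset //; exact: can_inj fK.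
left; exists 0 => k; rewrite add0n; apply/eqP; rewrite -(label_eq h2).
by rewrite -[label h2 (pos _)]/(f' _) /enum_labels g'K.
Qed.

(** For [3 <= r] the given isomorphism is kept; for [r = 2] it may fail to follow the order and is
    replaced by one that does. *)
Lemma whirl_aligned (R : realType) (d : Order.disp_t) (E : finOrderType d) (r : nat)
    (P : matroid E) (r2 : 2 <= r) : positroid R P -> isomorphic (bases P) (whirl r) ->
  exists f g, [/\ cancel f g, cancel g f,
    forall B : {set E}, (f @: B \in whirl r) = (B \in bases P)
    & aligned r (enum_labels r2 g)].
Proof.
move=> posP [f [[g fK gK] whirlP]].
have [r3|] := leqP 3 r; last first.
  move=> r3; have e : r = 2 by lia.
  by subst r; apply: whirl2_aligned whirlP.
exists f, g; split=> //.
have -> : r2 = ltnW r3 by apply: bool_irrelevance.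
apply: (positroid_aligned r3 _ _ _ _ posP).
- exact: enum_labels_eq.
- exact: enum_labels_surj fK.
- exact: (whirl_card _ gK whirlP).
exact: (whirl_triangular _ fK gK whirlP).
Qed.

Lemma matroid_eqE (E : finType) (M N : matroid E) : (M == N) = (bases M == bases N).
Proof. exact: esym (val_eqE M N). Qed.

Lemma nth4_inj (a b c e : nat) : a < b -> b < c -> c < e ->
  forall i j : 'I_4, nth 0 [:: a; b; c; e] i = nth 0 [:: a; b; c; e] j -> i = j.
Proof.
move=> ab bc ce i j eij; apply: val_inj; move: eij.
by case: i j => -[|[|[|[|//]]]] i4 [] [|[|[|[|//]]]] j4 //=; lia.
Qed.

Theorem corollary3p16 (R : realType) (d : Order.disp_t) (E : finOrderType d)
    (r : nat) (P : matroid E) (hr : (2 <= r)%N) (hP : positroid R P)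
    (hW : isomorphic (bases P) (whirl r)) :
  exists M : 4.-tuple (matroid E),
    [/\ uniq M,
        forall X : matroid E, (X \in positroid_envelope P) = (X \in M),
        forall i : 'I_4,
          isomorphic (bases (tnth M i)) (tnth (whirl_envelope_list r) i)
      & (3 <= r)%N -> forall i j : 'I_4,
          isomorphic (bases (tnth M i)) (tnth (whirl_envelope_list r) j) ->
          i = j].
Proof.
have [f [g [fK gK whirlP al]]] := whirl_aligned hr hP hW.
set u := enum_labels hr g in al.
have u_eq : forall j k, (u j == u k) = (j == k %[mod r.*2]) := enum_labels_eq hr gK.
have u_surj : forall x, exists k, x = u k := enum_labels_surj hr fK.
have P_card : forall B, B \in bases P -> #|B| = r := whirl_card hr gK whirlP.
have triP : triangular u P := whirl_triangular hr fK gK whirlP.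
have RP : rims r u \in bases P := rims_basis hr gK whirlP.
have aP := triangular_arc_rank hr u_eq u_surj P_card triP.
pose one : {set {set E}} := [set B : {set E} | one_spoke r u B].
have [ax0 ax1] : basis_axioms one /\ basis_axioms (rims r u |: one).
  split; [exact: (basis_axioms_one_spoke hr u_eq)|exact: (basis_axioms_one_spoke_relaxed u_eq)].
have ax2 := basis_axioms_unrelaxed hr u_eq u_surj P_card triP RP.
pose M := [tuple Matroid ax0; Matroid ax1; Matroid ax2; P].
have Rone : rims r u \notin one := one_spoke_proper r u.
have sub := one_spoke_sub hr u_eq u_surj P_card triP.
have Sone : ~: rims r u \notin one := all_spokes_not_one hr u_eq u_surj.
have SP : ~: rims r u \in bases P := all_spokes_basis hr u_eq u_surj P_card triP.
have SR : ~: rims r u != rims r u := all_spokes_neq hr u_eq.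
have finj := can_inj fK.
have fR : f @: rims r u = rim r := f_rims hr gK.
have fone (B : {set E}) : (f @: B \in MN r) = (B \in one).
  have -> : (f @: B \in MN r) = _ := Ngraph_bases hr _.
  rewrite inE -fR card_imset // (_ : _ :\: _ = f @: (B :\: rims r u)) ?card_imset //.
  apply/setP=> x; rewrite -(gK x) inE !(mem_imset _ _ finj) inE; done.
have fRE (B : {set E}) : (f @: B == rim r) = (B == rims r u).
  by rewrite -fR (inj_eq (imset_inj finj)).
(* As the rim is a cycle of the wheel, deleting it from the bases of the whirl gives back exactly
   [MW r]. *)
have RMW : rim r \notin MW r.
  apply/negP; rewrite inE => /maxsetp.
  by rewrite (acyclicPn (rim_is_cycle hr (G := wheel r) (fun=> erefl)) (subxx _)).
have fMW (B : {set E}) : (f @: B \in MW r) = (B \in bases P :\ rims r u).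
  rewrite in_setD1 -whirlP -fRE in_setU1.
  have [->|_] := eqVneq (f @: B) (rim r); first exact: negbTE.
  by rewrite andTb orFb; reflexivity.
have isoM i : isomorphic (bases (tnth M i)) (tnth (whirl_envelope_list r) i).
  exists f; split=> [|B]; first by exists g.
  case: i => -[|[|[|[|//]]]] i4; rewrite !(tnth_nth (Matroid ax0)) !(tnth_nth set0) /=;
    [exact: fone | by rewrite !in_setU1 fRE fone | exact: fMW | exact: whirlP].
exists M; split=> //.
- have neq (A B : {set {set E}}) C : C \in A -> C \notin B -> (B == A) = false.
    by move=> CA CB; apply: contraNF CB => /eqP ->.
  have Rin : rims r u \in rims r u |: one by rewrite setU11.
  have Sin : ~: rims r u \in bases P :\ rims r u by rewrite in_setD1 SR.
  have Snin : ~: rims r u \notin rims r u |: one by rewrite in_setU1 negb_or SR.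
  have Rnin : rims r u \notin bases P :\ rims r u by rewrite setD11.
  rewrite /= !inE !matroid_eqE /=.
  rewrite (neq _ _ _ Rin Rone) (neq _ _ _ Sin Sone) (neq _ _ _ SP Sone).
  by rewrite (neq _ _ _ Sin Snin) (neq _ _ _ SP Snin) (neq _ _ _ RP Rnin).
- move=> X; have env := arc_ranked_bases hr u_eq u_surj X P_card triP RP.
  have -> : (X \in M) = (bases X \in [:: one; rims r u |: one; bases P :\ rims r u; bases P]).
    by rewrite !inE !matroid_eqE.
  have al' := aligned_envelope hr u_eq u_surj X al aP.
  by apply/idP/idP=> [/al'/env|/env/al'].
(* Isomorphic families have equally many members, and for [3 <= r] the four numbers of bases
   increase strictly along [M]. *)
move=> r3 i j iso; have := isomorphic_card iso; rewrite -(isomorphic_card (isoM j)).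
have lt01 : #|one| < #|rims r u |: one| by rewrite cardsU1 Rone.
have lt12 := card_one_spoke_lt hr u_eq u_surj P_card triP r3 RP.
have lt23 : #|bases P :\ rims r u| < #|bases P| by rewrite [X in _ < X](cardsD1 (rims r u)) RP.
have cE k : #|bases (tnth M k)| =
    nth 0 [:: #|one|; #|rims r u |: one|; #|bases P :\ rims r u|; #|bases P|] k.
  by case: k => -[|[|[|[|//]]]] k4; rewrite (tnth_nth (Matroid ax0)).
by rewrite !cE; apply: nth4_inj.
Qed.
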